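(* Let $0<p\le 2$. Then $$M_p(r)=\max_{a\in[0,1]}\left[a^p+\frac{r(1-a^2)^p}{1-ra^p}\right]\quad\text{for } 0\le r\le 2^{p/2-1},$$ and $$M_p(r)<\left(\frac{1}{1-r^{2/(2-p)}}\right)^{1-p/2}\quad\text{for } 2^{p/2-1}<r<1.$$
   Context: $\mathbb{D}=\{z\in\mathbb{C}:|z|<1\}$. $\mathcal{B}$ is the class of analytic functions $f(z)=\sum_{k=0}^\infty a_kz^k$ on $\mathbb{D}$ with $|f(z)|<1$ for all $z\in\mathbb{D}$. For $p>0$ and $f\in\mathcal{B}$, the powered Bohr sum is $M_p^f(r)=\sum_{k=0}^\infty |a_k|^p r^k$, and $M_p(r):=\sup_{f\in\mathcal{B}}M_p^f(r)$. When $p=2$ the second range of $r$ is empty. In the only degenerate case $p=2$, $r=1$, $a=1$, the quotient $\frac{r(1-a^2)^p}{1-ra^p}$ is read as $0$ (its limit as $a\to1^-$). *)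

(* Defs.v *)
From HB Require Import structures.
From mathcomp Require Import all_boot all_order all_algebra.
From mathcomp Require Import complex.
From mathcomp Require Import all_classical all_reals all_analysis.

Set Implicit Arguments.
Unset Strict Implicit.
Unset Printing Implicit Defensive.

Import Order.TTheory GRing.Theory Num.Theory numFieldNormedType.Exports.

Local Open Scope classical_set_scope.
Local Open Scope ring_scope.

(* The norm topology is inherited from the structure [numClosedFieldType]; it
   is not found on the bare type [R[i]], hence this definition. *)
Definition Cplx (R : realType) : numClosedFieldType := R[i].

Definition power_series_on_disc (R : realType)
    (f : Cplx R -> Cplx R) (a : nat -> Cplx R) : Prop :=
  forall z : Cplx R, `|z| < 1 -> [series a k * z ^+ k]_k @ \oo --> f z.

(* Analyticity on the unit disc is expressed by the existence of a power series
   centred at 0 that converges to [f] on the whole disc. The values of [f]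
   outside the disc are irrelevant. *)
Definition bohr_class (R : realType) : set (Cplx R -> Cplx R) :=
  [set f | (exists a, power_series_on_disc f a) /\
           (forall z : Cplx R, `|z| < 1 -> `|f z| < 1)].

(* [normc] is the [R]-valued modulus. As [0 `^ p = 0] for [p != 0], zero
   coefficients do not contribute; and [0 ^+ 0 = 1], so the value at [r = 0] is
   the term of index 0. The sum is extended-real valued, so it makes sense
   without any convergence hypothesis when [0 <= r]. *)
Definition powered_bohr_sum (R : realType) (p : R) (a : nat -> Cplx R) (r : R)
    : \bar R :=
  (\sum_(0 <= k <oo) (ComplexField.Normc.normc (a k) `^ p * r ^+ k)%:E)%E.

Definition powered_bohr_sup (R : realType) (p r : R) : \bar R :=
  ereal_sup [set m | exists f a, [/\ bohr_class f, power_series_on_disc f a &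
                                     m = powered_bohr_sum p a r]].

(* Division by zero occurs only for [p = 2], [r = a = 1] (under [0 < p <= 2],
   [0 <= a <= 1] and [0 <= r <= 2 `^ (p / 2 - 1)]); there the quotient is
   [0 / 0 = 0], which is its limit as [a] tends to 1 from the left. *)
Definition bohr_bracket (R : realType) (p r a : R) : R :=
  a `^ p + r * (1 - a ^+ 2) `^ p / (1 - r * a `^ p).

Definition is_maximum (R : realType) (A : set R) (m : R) : Prop :=
  A m /\ ubound A m.

(* Main.v *)
Require Import Defs.
From mathcomp Require Import all_boot all_order all_algebra.
From mathcomp Require Import all_solvable all_field.
From mathcomp Require Import complex.
From mathcomp Require Import all_classical all_reals all_analysis.
From mathcomp Require Import ring lra zify.

Set Implicit Arguments.
Unset Strict Implicit.
Unset Printing Implicit Defensive.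

Import Order.TTheory GRing.Theory Num.Theory numFieldNormedType.Exports.

Local Open Scope classical_set_scope.
Local Open Scope ring_scope.

(** Write [p = 2 * q].

    Multiplication by a function that is bounded by 1 on the disc does not
    increase the l^2 norm of a sequence of coefficients: the lower triangular
    Toeplitz matrix of the coefficients [a k] is a contraction
    ([bohr_class_contraction], by Parseval's formula on circles of radius
    [s < 1], then [s -> 1]).  All upper bounds follow from this property.  On
    vectors with two nonzero entries it gives [\sum_k `|a k| ^+ 2 <= 1] and the
    sharper [toeplitz_tail], hence, after summation by parts
    ([weighted_tail_bound]),
    [\sum_(k >= 1) `|a k|^2 rho^k <= rho (1 - `|a 0|^2)^2 / (1 - rho `|a 0|^2)]
    for [0 <= rho <= 1], with equality for the disc automorphism
    [(a - z) / (1 - a z)].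

    The step from the exponent 2 to [p] uses that the concave function [x^q]
    lies below its tangents.  The tangent is taken at the squares [v_k^2] of a
    comparison sequence [v_k = c b^k]; its slope times [r^k] is again geometric
    in [k], of ratio [rho = r b^(p-2)], so that the tangents add up to a sum
    estimated above ([geometric_tangent]).  For [p < 2], let
    [t = r^(2 / (2 - p))]; then [r <= 2^(p/2 - 1)] means [t <= 1/2].  There are
    three cases, of which only the first occurs for [p = 2].
    - If [`|a 0|^2 >= t], compare with the automorphism with [a = `|a 0|]; here
      [rho <= 1], and the bound is the bracket at [`|a 0|].
    - If [`|a 0|^2 < t <= 1/2], compare with the automorphism with [a^2 = t];
      here [rho = 1], and the bound is the bracket at [a].
    - If [t > 1/2], compare with [v_k^2 = (1 - t) t^k]; here [rho = 1], and the
      bound is [(1 / (1 - t))^(1 - q)] diminished by a multiple of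
      [\sum_k (`|a k| - v_k)^2] ([powered_sum_deficit]).
    The automorphisms show that the supremum is not smaller than the bracket
    ([bracket_le_sup]), which settles the first range of [r].

    For the strict inequality in the second range, the moduli of a Toeplitz
    contraction have to stay away from the sequence [v_k]
    ([contraction_gap]).  Toeplitz contractions form a compact set for
    coordinatewise convergence ([contraction_compact]), so it is enough that no
    Toeplitz contraction satisfies [`|a k| = v_k] for all [k]
    ([geometric_moduli_impossible]).  Assume that one does.  As
    [\sum_k `|a k|^2 = 1], the contraction property forces
    [\sum_k a (m + k) (a k)^* = 0] for all [m >= 1] ([autocorrelation]): [a] is
    the coefficient sequence of an inner function.  An element [w] of the span
    of the shifted sequences [(a (k + n))_k], [n >= 1], is orthogonal to all
    forward shifts of [a], and Bessel's inequality gives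
    [`|w k|^2 <= t^(k+1) ||w||^2].  Summation over an orthonormal family and over
    [k] bounds the dimension of the span by [t / (1 - t)].  Hence
    [a 1, a 2, ...] satisfies a linear recurrence ([exists_recurrence]).  The
    orthogonality relations prolong this recurrence to the index 0 if [a 0] is
    replaced by [b 0 = - t / (a 0)^*] ([recurrence_extends]).  The squared moduli
    of a sequence with a linear recurrence satisfy a linear recurrence too, so
    that [`|b n|^2 = (1 - t) t^n], true for [n >= 1], also holds for [n = 0]
    ([recurrence_backward_norm]).  Thus [t^2 / (1 - t) = 1 - t] and [t = 1/2]. *)

(** * Toeplitz contractions *)

(** The condition is stated on the finite truncations of the matrix: each
    instance involves finitely many coefficients, so the condition passes to
    coordinatewise limits. *)
Definition toeplitz_contraction (C : numClosedFieldType) (a : nat -> C) :=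
  forall n (x : nat -> C),
   \sum_(k < n) `|\sum_(l < k.+1) a (k - l)%N * x l| ^+ 2
     <= \sum_(k < n) `|x k| ^+ 2.

Section ToeplitzContraction.
Variables (C : numClosedFieldType) (a : nat -> C).
Hypothesis Ta : toeplitz_contraction a.

Lemma sum_delta (g : nat -> C) m k :
  \sum_(l < k) g l * (l == m :> nat)%:R = if (m < k)%N then g m else 0.
Proof.
elim: k => [|k IH]; first by rewrite big_ord0.
rewrite big_ord_recr /= IH; case: (ltngtP m k) => [mk|km|<-].
- by rewrite ltnS (ltnW mk) mulr0 addr0.
- by rewrite ltnS leqNgt km mulr0 addr0.
- by rewrite ltnS leqnn mulr1 add0r.
Qed.

Lemma sum_norm_delta2 (c : C) m n : (0 < m < n)%N ->
  \sum_(k < n) `|(k == 0 :> nat)%:R + c * (k == m :> nat)%:R| ^+ 2 = 1 + `|c| ^+ 2.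
Proof.
move=> /andP[m0 mn].
transitivity (\sum_(k < n) (1 * (k == 0 :> nat)%:R + `|c| ^+ 2 * (k == m :> nat)%:R) : C).
  apply: eq_bigr => k _; case: (eqVneq (k : nat) 0%N) => [->|k0].
    by rewrite eq_sym (gtn_eqF m0) !mulr0 !addr0 normr1 expr1n mulr1.
  rewrite add0r mulr0 add0r; case: eqP => _; first by rewrite !mulr1.
  by rewrite !mulr0 normr0 expr0n.
rewrite big_split /= (sum_delta (fun=> 1)) (sum_delta (fun=> `|c| ^+ 2)) mn.
by rewrite (ltn_trans m0 mn).
Qed.

(** The contraction property on the vector [e_0 + c e_m]: the rows of index less
    than [m] do not see [c]. *)
Lemma toeplitz_two_term (c : C) m n : (0 < m)%N -> (0 < n)%N ->
  \sum_(k < m) `|a k| ^+ 2 + \sum_(k < n) `|a (m + k)%N + c * a k| ^+ 2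
    <= 1 + `|c| ^+ 2.
Proof.
move=> m0 n0.
have := Ta (m + n) (fun l => (l == 0)%:R + c * (l == m)%:R).
rewrite sum_norm_delta2 ?m0 -1?[X in (X < _)%N]addn0 ?ltn_add2l //.
apply: le_trans.
rewrite big_split_ord /= le_eqVlt; apply/orP; left; apply/eqP.
have E k : \sum_(l < k.+1) a (k - l)%N * ((l == 0%N :> nat)%:R + c * (l == m :> nat)%:R)
   = a k + (if (m <= k)%N then c * a (k - m)%N else 0).
  under eq_bigr do rewrite mulrDr mulrA.
  rewrite big_split /= (sum_delta (fun l => a (k - l)%N)) subn0 /=.
  by rewrite (sum_delta (fun l => a (k - l)%N * c)) ltnS mulrC.
congr (_ + _); apply: eq_bigr => k _; rewrite E.
  by rewrite leqNgt ltn_ord addr0.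
by rewrite leq_addr addKn.
Qed.

Lemma toeplitz_sum_le1 n : \sum_(k < n) `|a k| ^+ 2 <= 1.
Proof.
case: n => [|n]; first by rewrite big_ord0 ler01.
have := @toeplitz_two_term 0 n.+1 1 isT isT.
rewrite normr0 expr0n addr0; apply: le_trans.
by rewrite lerDl sumr_ge0 // => i _; rewrite exprn_ge0.
Qed.

(** Reversal of the order of the indices turns a Toeplitz matrix into its
    transpose, so the adjoint matrix is a contraction too. *)
Lemma toeplitz_adjoint n (y : nat -> C) :
  \sum_(k < n) `|\sum_(l < n | (k <= l)%N) (a (l - k)%N)^* * y l| ^+ 2
     <= \sum_(k < n) `|y k| ^+ 2.
Proof.
have := Ta n (fun l => (y (n - l.+1)%N)^*).
rewrite (reindex_inj rev_ord_inj) /= [leRHS](reindex_inj rev_ord_inj) /=.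
have E (k : 'I_n) : `|(y (n - (n - k.+1).+1)%N)^*| ^+ 2 = `|y k| ^+ 2.
  by rewrite norm_conjC subnSK // subKn // ltnW.
under [leRHS]eq_bigr do rewrite E.
apply: le_trans; rewrite le_eqVlt; apply/orP; left; apply/eqP.
apply: eq_bigr => k _; rewrite -norm_conjC rmorph_sum /=; congr (`|_| ^+ 2).
rewrite (reindex_inj rev_ord_inj) /=.
rewrite -(big_mkord (fun l => k <= n - l.+1)%N
   (fun l => ((a (n - l.+1 - k)%N)^* * y (n - l.+1)%N)^*)).
rewrite -(big_mkord xpredT
   (fun l => a (n - k.+1 - l)%N * (y (n - l.+1)%N)^*)).
have kn := ltn_ord k.
rewrite (big_cat_nat (n := (n - k.+1).+1)) //=; last by lia.
rewrite [X in _ + X]big_nat_cond [X in _ + X]big1 ?addr0; last first.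
  by move=> i; lia.
rewrite [RHS]big_nat_cond [LHS]big_nat_cond; apply: eq_big => [i|i].
  by lia.
move=> /andP[/andP[_ h]] _; rewrite rmorphM /= conjCK; congr (a _ * _); lia.
Qed.

End ToeplitzContraction.

(** The two-term inequality with the value of [c] that makes it sharpest; for
    this value [a n.+1 + c * a 0 = a n.+1 / D]. *)
Lemma toeplitz_tail (C : numClosedFieldType) (a : nat -> C) n :
  toeplitz_contraction a -> `|a 0%N| < 1 ->
  (1 - `|a 0%N| ^+ 2) * (\sum_(k < n) `|a k.+1| ^+ 2) + `|a n.+1| ^+ 2
     <= (1 - `|a 0%N| ^+ 2) ^+ 2.
Proof.
move=> Ta a1; set D := 1 - _.
have D0 : 0 < D by rewrite /D subr_gt0 exprn_ilt1.
have Dn : D != 0 by rewrite gt_eqF.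
have DA : `|a 0%N| ^+ 2 = 1 - D by rewrite /D opprB addrC subrK.
have := @toeplitz_two_term _ _ Ta ((a 0%N)^* * a n.+1 / D) n.+1 1 isT isT.
rewrite big_ord_recl big_ord1 addn0 DA.
have -> : a n.+1 + (a 0%N)^* * a n.+1 / D * a 0%N = a n.+1 / D.
  have e : a 0%N * (a 0%N)^* = 1 - D by rewrite -normCK DA.
  apply: (mulIf Dn); rewrite divfK // mulrDl mulrAC divfK //.
  by rewrite mulrAC [_^* * _]mulrC e; ring.
rewrite !normrM normfV norm_conjC (ger0_norm (ltW D0)) !exprMn exprVn DA /bump /=.
move: (\sum_(i < n) _) (`|a n.+1| ^+ 2) => S X h.
rewrite -subr_ge0; have := mulr_ge0 (ltW D0); rewrite -subr_ge0 in h => /(_ _ h).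
congr (0 <= _); by field.
Qed.

(** * Coefficients of bounded functions *)

Section Parseval.
Variable C : numClosedFieldType.

Lemma prim_root_exists n : (0 < n)%N -> exists w : C, n.-primitive_root w.
Proof.
pose p : {poly C} := 'X^n - 1; have [r Dp] := closed_field_poly_normal p.
move=> n_gt0; rewrite (monicP _) ?monicXnsubC // scale1r in Dp.
have rn1 : all n.-unity_root r by apply/allP=> z; rewrite -root_prod_XsubC -Dp.
have sz_r : (n < (size r).+1)%N.
  by rewrite -(size_prod_XsubC r id) -Dp size_XnsubC.
have [|z] := hasP (has_prim_root n_gt0 rn1 _ sz_r); last by exists z.
by rewrite -separable_prod_XsubC -Dp separable_Xn_sub_1 // pnatr_eq0 -lt0n.
Qed.

Lemma norm_prim_root n (w : C) : n.-primitive_root w -> `|w| = 1.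
Proof.
move=> w_prim; apply/eqP; rewrite -(@pexpr_eq1 _ _ n) ?(prim_order_gt0 w_prim) ?normr_ge0 //.
by rewrite -normrX (prim_expr_order w_prim) normr1.
Qed.

Lemma sum_prim_root_orth n (w : C) (k l : 'I_n) : n.-primitive_root w ->
  \sum_(j < n) w ^+ (j * k) * (w ^+ (j * l))^* = n%:R * (k == l)%:R.
Proof.
move=> w_prim; have nw := norm_prim_root w_prim.
have w0 : w != 0 by rewrite -normr_eq0 nw oner_eq0.
have cw : w^* = w^-1.
  by apply: (mulfI w0); rewrite -normCK nw expr1n divff.
pose x := w ^+ k / w ^+ l.
have -> : \sum_(j < n) w ^+ (j * k) * (w ^+ (j * l))^* = \sum_(j < n) x ^+ j.
  apply: eq_bigr => j _; rewrite rmorphXn /= cw exprVn /x exprMn exprVn.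
  by rewrite -!exprM !(mulnC j).
have [e|kl] := eqVneq k l.
  rewrite /x e divff ?expf_neq0 //; under eq_bigr do rewrite expr1n.
  by rewrite sumr_const card_ord mulr1.
have x1 : x - 1 != 0.
  rewrite subr_eq0 /x; apply: contra kl => /eqP e.
  have : w ^+ k == w ^+ l by rewrite -[X in _ == X]mul1r -e divfK // expf_neq0.
  by rewrite (eq_prim_root_expr w_prim) !modn_small.
apply: (mulfI x1); rewrite -subrX1 !mulr0 /x exprMn exprVn -!exprM ![(_ * n)%N]mulnC.
by rewrite !exprM (prim_expr_order w_prim) !expr1n divr1 subrr.
Qed.

(** Parseval's formula with the integral over the circle replaced by a mean over
    roots of unity, which is exact for polynomials of low degree. *)
Lemma discrete_parseval n (w s : C) (p : {poly C}) :
  n.-primitive_root w -> (size p <= n)%N ->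
  \sum_(j < n) `|p.[s * w ^+ j]| ^+ 2 = n%:R * \sum_(k < n) `|p`_k * s ^+ k| ^+ 2.
Proof.
move=> w_prim pn; pose c k := p`_k * s ^+ k.
have -> : \sum_(j < n) `|p.[s * w ^+ j]| ^+ 2 =
  \sum_(j < n) \sum_(k < n) \sum_(l < n) (c k * (c l)^*) * (w ^+ (j * k) * (w ^+ (j * l))^*).
  apply: eq_bigr => j _; rewrite normCK (horner_coef_wide _ pn) rmorph_sum /= mulr_suml.
  apply: eq_bigr => k _; rewrite mulr_sumr; apply: eq_bigr => l _.
  by rewrite !exprMn -!exprM /c !rmorphM /=; ring.
rewrite exchange_big mulr_sumr; apply: eq_bigr => k _ /=.
rewrite exchange_big /=; under eq_bigr do rewrite -mulr_sumr (sum_prim_root_orth _ _ w_prim).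
rewrite (bigD1 k) //= eqxx mulr1 big1 ?addr0 => [|l lk].
  by rewrite mulrC -normCK.
by rewrite eq_sym (negbTE lk) !mulr0.
Qed.

(** Both sides are means over the same sample points, as soon as there are more
    of them than coefficients in [f * q]. *)
Lemma circle_multiplier (f q : {poly C}) (s B : C) n : 0 <= s -> 0 <= B ->
  (forall z, `|z| = s -> `|f.[z]| <= B) -> (size q <= n)%N ->
  \sum_(k < n) `|(f * q)`_k * s ^+ k| ^+ 2 <= B ^+ 2 * \sum_(k < n) `|q`_k * s ^+ k| ^+ 2.
Proof.
move=> s0 B0 fB qn; pose N := (n + size f).+1.
have [w w_prim] := prim_root_exists (ltn0Sn (n + size f)).
rewrite -/N in w_prim.
have sz1 : (size (f * q)%R <= N)%N.
  apply: leq_trans (size_polyMleq _ _) _; rewrite /N; lia.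
have sz2 : (size q <= N)%N by rewrite /N; lia.
have splitN (g : nat -> C) :
  \sum_(k < N) g k = \sum_(k < n) g k + \sum_(k < (size f).+1) g (n + k)%N.
  by rewrite /N -addnS big_split_ord.
have -> : \sum_(k < n) `|q`_k * s ^+ k| ^+ 2 = \sum_(k < N) `|q`_k * s ^+ k| ^+ 2.
  rewrite (splitN (fun k => `|q`_k * s ^+ k| ^+ 2)) [X in _ = _ + X]big1 ?addr0 // => i _.
  by rewrite nth_default ?mul0r ?normr0 ?expr0n // (leq_trans qn) ?leq_addr.
apply: (@le_trans _ _ (\sum_(k < N) `|(f * q)`_k * s ^+ k| ^+ 2)).
  by rewrite (splitN (fun k => `|(f * q)`_k * s ^+ k| ^+ 2)) lerDl sumr_ge0.
have N0 : 0 < N%:R :> C by rewrite ltr0n.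
rewrite -(ler_pM2l N0) mulrCA -!(discrete_parseval _ w_prim) // mulr_sumr ler_sum // => j _.
rewrite hornerM normrM exprMn ler_wpM2r ?exprn_ge0 // ler_pXn2r ?nnegrE // fB //.
by rewrite normrM normrX (norm_prim_root w_prim) expr1n mulr1 ger0_norm.
Qed.

End Parseval.

Section BoundedFunctions.
Variable R : realType.
Local Notation C := (Cplx R).
Local Notation normc := (@ComplexField.Normc.normc R).
Local Notation toC := (fun x : R => (x%:C)%C : C).

Lemma ge0_Re (x : C) : 0 <= x -> x = toC (complex.Re x).
Proof. by rewrite lecE /= => /andP[/eqP + _]; case: x => u v /= ->. Qed.

Lemma geometric_small (t e K : C) : 0 <= t < 1 -> 0 < e -> 0 <= K ->
  exists N, forall n, (N <= n)%N -> K * t ^+ n <= e.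
Proof.
move=> /andP[t0 t1] e0 K0.
have := ge0_Re K0; have := ge0_Re (ltW e0); have := ge0_Re t0.
move: t0 t1 e0 K0.
move: (complex.Re t) (complex.Re e) (complex.Re K) => u v w + + + + tu ev Kw.
rewrite {}tu {}ev {}Kw.
rewrite -[1]/(toC 1) -[0]/(toC 0) !lecR !ltcR => t0 t1 e0 K0.
have : `|u| < 1 by rewrite ger0_norm.
move=> /(cvg_geometric w) /cvgrPdist_lt /(_ _ e0)[N _ H].
exists N => n /H /=; rewrite sub0r normrN ger0_norm ?mulr_ge0 ?exprn_ge0 // => /ltW h.
by rewrite -rmorphXn -rmorphM /= lecR.
Qed.

(** The form in which [t ^+ n --> 0] is used for the rigidity of geometric
    moduli. *)
Lemma geometric_null (t x K : C) : 0 <= t < 1 -> 0 <= K ->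
  (forall n, x <= K * t ^+ n) -> x <= 0.
Proof.
move=> t01 K0 h; have t0 : 0 <= t by case/andP: t01.
have xr : x \is Num.real.
  have Kr : K * t ^+ 0 \is Num.real by rewrite ger0_real ?mulr_ge0 ?exprn_ge0.
  by have := ler_real (h 0%N); rewrite Kr => ->.
rewrite real_leNgt ?real0 //; apply/negP => x0.
have x2 : 0 < x / 2 by rewrite divr_gt0.
have [N /(_ N (leqnn _)) H] := geometric_small t01 x2 K0.
have : x / 2 < x by rewrite ltr_pdivrMr // mulr_natr mulr2n ltrDl.
by move=> /lt_le_trans /(_ (le_trans (h N) H)); rewrite ltxx.
Qed.

Definition partial_sum (a : nat -> C) m : {poly C} := \poly_(k < m) a k.

Lemma partial_sumE (a : nat -> C) m z :
  (partial_sum a m).[z] = series (fun k => a k * z ^+ k) m.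
Proof.
rewrite (horner_coef_wide _ (size_poly _ _)) /series /= big_mkord.
by apply: eq_bigr => k _; rewrite coef_poly ltn_ord.
Qed.

(** The terms of the series are bounded on a circle of larger radius [s'], so the
    remainders on the circle of radius [s] are dominated by a geometric series of
    ratio [s / s'], uniformly in [z]. *)
Lemma partial_sum_circle (f : C -> C) (a : nat -> C) (s e : C) :
  bohr_class f -> power_series_on_disc f a -> 0 <= s < 1 -> 0 < e ->
  exists N, forall m, (N <= m)%N -> forall z, `|z| = s -> `|(partial_sum a m).[z]| <= 1 + e.
Proof.
move=> [_ fb] fa /andP[s0 s1] e0.
pose s' : C := (s + 1) / 2.
have s'1 : s' < 1 by rewrite /s' ltr_pdivrMr // mul1r -[2]/(1 + 1) ltrD2r.
have ss' : s < s' by rewrite /s' ltr_pdivlMr // mulr_natr mulr2n ltrD2l.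
have s'0 : 0 < s' := le_lt_trans s0 ss'.
have s'0' := ltW s'0.
have [B B0 HB] : exists2 B : C, 0 <= B & forall k, `|a k| * s' ^+ k <= B.
  have := fa s'; rewrite ger0_norm ?(ltW s'0) // => /(_ s'1).
  move=> /cvgrPdist_lt /(_ _ ltr01)[N _ H].
  exists (2 + \sum_(k < N) `|a k| * s' ^+ k).
    by rewrite addr_ge0 // sumr_ge0 // => i _; rewrite mulr_ge0 ?exprn_ge0.
  have p0 k : 0 <= `|a k| * s' ^+ k by rewrite mulr_ge0 ?exprn_ge0.
  move=> k; case: (ltnP k N) => [kN|Nk].
    by rewrite (bigD1 (Ordinal kN)) //= addrCA lerDl addr_ge0 // sumr_ge0.
  apply: (@le_trans _ _ 2); last by rewrite lerDl sumr_ge0.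
  have h1 := H k Nk; have h2 := H k.+1 (leqW Nk).
  have -> : `|a k| * s' ^+ k = `|a k * s' ^+ k|.
    by rewrite normrM normrX [`|s'|]ger0_norm // ltW.
  have -> : a k * s' ^+ k = (f s' - series (fun k => a k * s' ^+ k) k)
      - (f s' - series (fun k => a k * s' ^+ k) k.+1).
    by rewrite seriesSr; ring.
  apply: le_trans (ler_normB _ _) _; rewrite -[2]/(1 + 1) lerD // ltW //.
pose th := s / s'.
have th0 : 0 <= th by rewrite divr_ge0 // ltW.
have th1 : th < 1 by rewrite ltr_pdivrMr // mul1r.
have th01 : 0 <= th < 1 by rewrite th0.
have K0 : 0 <= B / (1 - th) by rewrite divr_ge0 // subr_ge0 ltW.
have e2 : 0 < e / 2 by rewrite divr_gt0.
have [N HN] := geometric_small th01 e2 K0.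
exists N => m Nm z zs; rewrite partial_sumE.
set S := series _.
have z1 : `|z| < 1 by rewrite zs.
have := fa z z1 => /cvgrPdist_lt /(_ _ e2)[M _ HM].
have {}HM := HM (m + M)%N (leq_addl _ _).
have tail : `|S (m + M)%N - S m| <= e / 2.
  apply: le_trans (HN m Nm).
  rewrite /S /series /= (big_cat_nat (n := m)) ?leq_addr //= addrAC subrr add0r.
  rewrite -{1}[m]add0n [(m + M)%N]addnC big_addn addnK big_mkord.
  apply: le_trans (ler_norm_sum _ _ _) _.
  apply: (@le_trans _ _ (\sum_(i < M) B * th ^+ m * th ^+ i)).
    apply: ler_sum => i _; rewrite normrM normrX zs.
    have -> : B * th ^+ m * th ^+ i = s ^+ (i + m) * (B / s' ^+ (i + m)).
      by rewrite -mulrA -exprD [(m + i)%N]addnC /th exprMn exprVn mulrCA.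
    by rewrite mulrC ler_wpM2l ?exprn_ge0 // ler_pdivlMr ?exprn_gt0.
  rewrite -mulr_sumr mulrAC ler_wpM2r ?exprn_ge0 // ler_wpM2l //.
  rewrite -[leRHS]div1r ler_pdivlMr ?subr_gt0 // mulrC.
  by rewrite -opprB mulNr -subrX1 opprB lerBlDr lerDl exprn_ge0.
rewrite (_ : S m = f z - (f z - S (m + M)%N) - (S (m + M)%N - S m)); last by ring.
apply: le_trans (ler_normB _ _) _; rewrite (splitr e) addrA lerD //.
apply: le_trans (ler_normB _ _) _; rewrite lerD // ltW //; exact: fb.
Qed.

(** The entries of the Toeplitz matrix applied to [x] are the first coefficients
    of the product of a partial sum of the series with the polynomial [q] of
    coefficients [x]; on the circle of radius [s], the partial sum is bounded by
    [1 + e]. *)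
Lemma bohr_class_contraction (f : C -> C) (a : nat -> C) :
  bohr_class f -> power_series_on_disc f a -> toeplitz_contraction a.
Proof.
move=> fB fa n x.
pose y k := \sum_(l < k.+1) a (k - l)%N * x l.
set X := \sum_(k < n) `|x k| ^+ 2.
set L := \sum_(k < n) _.
have X0 : 0 <= X by rewrite sumr_ge0 // => i _; rewrite exprn_ge0.
have L0 : 0 <= L by rewrite sumr_ge0 // => i _; rewrite exprn_ge0.
(* [1 + e] is taken equal to [s^-1], so that a single parameter tends to 1. *)
have key (s : C) : 0 < s < 1 -> L * s ^+ (2 * n).+2 <= X.
  move=> /andP[s0 s1].
  have e0 : 0 < s^-1 - 1 by rewrite subr_gt0 invf_gt1.
  have s01 : 0 <= s < 1 by rewrite ltW.
  have [N HN] := partial_sum_circle fB fa s01 e0.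
  pose q : {poly C} := \poly_(k < n) x k.
  have iv0 : 0 <= s^-1 by rewrite invr_ge0 ltW.
  have bd z : `|z| = s -> `|(partial_sum a (N + n)).[z]| <= s^-1.
    by move=> /(HN (N + n)%N (leq_addr _ _)); rewrite addrC subrK.
  have := circle_multiplier (ltW s0) iv0 bd (size_poly n x : (size q <= n)%N).
  have -> : \sum_(k < n) `|(partial_sum a (N + n) * q)`_k * s ^+ k| ^+ 2
     = \sum_(k < n) `|y k * s ^+ k| ^+ 2.
    apply: eq_bigr => k _; congr (`|_ * _| ^+ 2).
    rewrite coefMr; apply: eq_bigr => l _.
    rewrite !coef_poly; have := ltn_ord k; have := ltn_ord l => lk kn.
    by rewrite (leq_ltn_trans (leq_subr l k) (ltn_addl _ kn)) (leq_ltn_trans _ kn).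
  move=> h.
  have h1 : L * s ^+ (2 * n) <= \sum_(k < n) `|y k * s ^+ k| ^+ 2.
    rewrite mulr_suml; apply: ler_sum => k _.
    rewrite normrM exprMn ler_wpM2l ?exprn_ge0 // ger0_norm ?exprn_ge0 ?(ltW s0) //.
    by rewrite -exprM ler_wiXn2l ?(ltW s0) ?(ltW s1) // mulnC leq_pmul2l // ltnW.
  have h2 : \sum_(k < n) `|q`_k * s ^+ k| ^+ 2 <= X.
    apply: ler_sum => k _; rewrite coef_poly ltn_ord normrM exprMn -[leRHS]mulr1.
    rewrite ler_wpM2l ?exprn_ge0 // ger0_norm ?exprn_ge0 ?(ltW s0) //.
    by rewrite exprn_ile1 ?exprn_ge0 ?exprn_ile1 ?(ltW s0) ?(ltW s1).
  rewrite -addn2 exprD mulrA.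
  have s2 : 0 < s ^+ 2 by rewrite exprn_gt0.
  rewrite -ler_pdivlMr //; apply: (le_trans h1); apply: (le_trans h).
  by rewrite exprVn mulrC ler_wpM2r // invr_ge0 ltW.
(* Let [s = 1 - 2^-(j+1)] and use Bernoulli's inequality for [s ^+ m]. *)
rewrite -subr_le0.
have half01 : 0 <= (2^-1 : C) < 1 by rewrite invr_ge0 ler0n invf_lt1 ?ltr1n.
apply: (geometric_null (K := L * ((2 * n).+2)%:R) half01) => [|j].
  by rewrite mulr_ge0.
pose d : C := 2^-1 ^+ j.+1.
have d0 : 0 < d by rewrite exprn_gt0 ?invr_gt0.
have d1 : d < 1 by rewrite exprn_ilt1 ?invr_ge0 ?invf_lt1 ?ltr1n.
have s01 : 0 < 1 - d < 1 by rewrite subr_gt0 d1 ltrBlDr ltrDl.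
have := key _ s01; move: (2 * n).+2 => m h.
rewrite lerBlDr -lerBlDl; apply: le_trans h.
rewrite -mulrA -[X in X - _]mulr1 -mulrBr ler_wpM2l //.
have b : 1 - (1 - d) ^+ m <= m%:R * d.
  rewrite -opprB subrX1 -mulNr opprB opprB addrC subrK mulrC ler_wpM2r ?(ltW d0) //.
  apply: (@le_trans _ _ (\sum_(i < m) 1)); last by rewrite sumr_const card_ord.
  apply: ler_sum => i _; case/andP: s01 => u v.
  by rewrite exprn_ile1 // ltW.
rewrite lerBlDr -lerBlDl; apply: (le_trans b).
rewrite ler_wpM2l // /d exprS -[leRHS]mul1r ler_wpM2r ?exprn_ge0 ?invr_ge0 //.
by rewrite ltW //; case/andP: half01.
Qed.

Lemma norm_normc (z : C) : `|z| = (normc z)%:C%C.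
Proof. by []. Qed.

Lemma norm_sqrE (z : C) : `|z| ^+ 2 = (normc z ^+ 2)%:C%C.
Proof. by rewrite norm_normc -rmorphXn. Qed.

Lemma normc_ge0 (z : C) : 0 <= normc z.
Proof. by rewrite -lecR; exact: (@normr_ge0 C C z). Qed.

Lemma contraction_sum_normc (a : nat -> C) n : toeplitz_contraction a ->
  \sum_(k < n) normc (a k) ^+ 2 <= 1.
Proof.
move=> Ta; rewrite -lecR rmorph_sum /=; under eq_bigr do rewrite -norm_sqrE.
exact: toeplitz_sum_le1.
Qed.

Lemma contraction_tail_normc (a : nat -> C) n : toeplitz_contraction a -> normc (a 0%N) < 1 ->
  (1 - normc (a 0%N) ^+ 2) * (\sum_(k < n) normc (a k.+1) ^+ 2) + normc (a n.+1) ^+ 2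
     <= (1 - normc (a 0%N) ^+ 2) ^+ 2.
Proof.
move=> Ta; rewrite -ltcR -norm_normc => /(toeplitz_tail n Ta).
have -> : \sum_(k < n) `|a k.+1| ^+ 2 = (\sum_(k < n) normc (a k.+1) ^+ 2)%:C%C.
  by rewrite rmorph_sum; apply: eq_bigr => k _; rewrite norm_sqrE.
rewrite !norm_sqrE -(rmorph1 (real_complex R)).
by rewrite -rmorphB -rmorphM -rmorphD -rmorphXn lecR.
Qed.

Lemma bohr_class_coef0 (f : C -> C) (a : nat -> C) :
  bohr_class f -> power_series_on_disc f a -> normc (a 0%N) < 1.
Proof.
move=> [_ fb] fa; rewrite -ltcR -norm_normc.
have z1 : `|0 : C| < 1 by rewrite normr0.
suff <- : f 0 = a 0%N by apply: fb.
apply/eqP; rewrite -subr_eq0 -normr_eq0 -[_ == 0]negbK; apply/negP => d.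
have d0 : 0 < `|f 0 - a 0%N| by rewrite lt_neqAle eq_sym d normr_ge0.
have := fa 0 z1 => /cvgrPdist_lt /(_ _ d0)[N _ /(_ N.+1 (leqnSn N))].
rewrite /series /= big_nat_recl // expr0 mulr1 big1 ?addr0 ?ltxx // => i _.
by rewrite expr0n mulr0.
Qed.

End BoundedFunctions.

(** * Rigidity of geometric moduli *)

Lemma sqr_normD_ge (C : numClosedFieldType) (x y : C) :
  `|y| ^+ 2 - 2 * `|x| * `|y| <= `|x + y| ^+ 2.
Proof.
have h : (`|y| - `|x|) ^+ 2 <= `|x + y| ^+ 2.
  rewrite -[leLHS]real_normK ?rpredB ?normr_real //.
  rewrite ler_pXn2r ?nnegrE //.
  by have := ler_dist_dist y (- x); rewrite normrN opprK [y + x]addrC.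
apply: le_trans h; rewrite -subr_ge0.
have -> : (`|y| - `|x|) ^+ 2 - (`|y| ^+ 2 - 2 * `|x| * `|y|) = `|x| ^+ 2 by ring.
by rewrite exprn_ge0.
Qed.

Lemma sum_ord_shift (C : nmodType) (F : nat -> C) l M : (l <= M)%N ->
  \sum_(j < M | (l <= j)%N) F j = \sum_(j < M - l) F (l + j)%N.
Proof.
move=> lM; rewrite -(big_mkord (fun j => l <= j)%N F).
rewrite (big_cat_nat (n := l)) //= [X in X + _]big_nat_cond big1 ?add0r; last first.
  by move=> i; lia.
transitivity (\sum_(l <= j < M) F j).
  by apply: congr_big_nat => // i /andP[-> _].
rewrite -{1}[l]add0n big_addn big_mkord.
by apply: eq_bigr => i _; rewrite addnC.
Qed.

Section Recurrence.
Variable (F : fieldType).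

(** The characteristic polynomial is monic, so Cayley-Hamilton expresses each
    [z n] by later terms with coefficients that do not depend on [n], even if [B]
    is singular.  Comparing the relations for [n = 0] and [n = 1] gives the
    claim. *)
Lemma backward_geometric m (B : 'M[F]_m.+1) (z : nat -> 'rV[F]_m.+1) j (c t : F) :
  t != 0 -> (forall n, z n = z n.+1 *m B) ->
  (forall n, z n.+1 0 j = c * t ^+ n.+1) -> z 0%N 0 j = c.
Proof.
move=> t0 zB zgeo; pose q := char_poly B; pose s n := \sum_(i < m.+1) q`_i * z (n + (m.+1 - i))%N 0 j.
have zX n i : z n = z (n + i)%N *m B ^+ i.
  elim: i => [|i IH]; first by rewrite addn0 expr0 mulmx1.
  by rewrite IH zB exprS -mulmxE mulmxA addnS.
(* The last summand is the leading term of [q]. *)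
have CH n : s n + z n 0 j = 0.
  have := Cayley_Hamilton B; rewrite -/q => /(congr1 (mulmx (z (n + m.+1)%N))).
  rewrite mulmx0 => /matrixP/(_ 0 j).
  rewrite [in LHS](_ : horner_mx B q = \sum_(i < m.+2) q`_i *: B ^+ i); last first.
    rewrite -[q in LHS]coefK poly_def rmorph_sum /= size_char_poly.
    by apply: eq_bigr => i _; rewrite linearZ /= rmorphXn /= horner_mx_X.
  rewrite big_ord_recr /= mulmxDr mulmx_sumr.
  have -> : q`_m.+1 = 1.
    by have := char_poly_monic B; rewrite monicE lead_coefE size_char_poly => /eqP.
  rewrite scale1r -zX !mxE summxE => <-; congr (_ + _); apply: eq_bigr => i _.
  rewrite -scalemxAr mxE; congr (_ * _).
  have im : (i < m.+1)%N := ltn_ord i.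
  by rewrite (zX (n + (m.+1 - i))%N i) -addnA subnK // ltnW.
have s1 : s 1%N = t * s 0%N.
  rewrite mulr_sumr; apply: eq_bigr => i _.
  have im : (i < m.+1)%N := ltn_ord i.
  rewrite add1n add0n zgeo (_ : (m.+1 - i)%N = (m - i).+1); last by lia.
  by rewrite zgeo exprS; move: (t ^+ _) => X; ring.
have := CH 1%N; rewrite zgeo s1 expr1 mulrC -mulrDl => /eqP.
rewrite mulf_eq0 (negbTE t0) orbF => /eqP h.
by have := CH 0%N; rewrite -h => /addrI.
Qed.

End Recurrence.

Section ProductRecurrence.
Variable (C : numClosedFieldType).

(** A window [u n] of consecutive terms depends linearly on [u n.+1], because
    [g 0 != 0].  Hence the matrices [(u n)^T *m conj (u n)] depend linearly on
    their successors, and [`|b n| ^+ 2] is one of their entries. *)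
Lemma recurrence_backward_norm (b : nat -> C) D (g : nat -> C) (c t : C) :
  t != 0 -> g 0%N != 0 ->
  (forall n, \sum_(j < D.+2) g j * b (n + j)%N = 0) ->
  (forall n, `|b n.+1| ^+ 2 = c * t ^+ n.+1) -> `|b 0%N| ^+ 2 = c.
Proof.
move=> t0 g0 rec bgeo.
pose u n : 'rV[C]_D.+1 := \row_i b (n + i)%N.
pose A : 'M[C]_D.+1 := \matrix_(j, i) if i == 0 then - g j.+1 / g 0%N else (j.+1 == i)%:R.
have uA n : u n = u n.+1 *m A.
  apply/rowP => i; rewrite !mxE.
  have [i0|i0] := eqVneq i 0.
    rewrite i0 addn0; apply: (mulfI g0).
    have := rec n; rewrite big_ord_recl /= addn0 => /eqP; rewrite addr_eq0 => /eqP ->.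
    rewrite mulr_sumr -sumrN; apply: eq_bigr => j _; rewrite !mxE eqxx.
    by rewrite /bump /= add1n addnS addSn; field.
  under eq_bigr do rewrite !mxE (negbTE i0) eq_sym.
  case: i i0 => -[|i] Hi i0; first by case/eqP: i0; apply/val_inj.
  under eq_bigr do rewrite /= eqSS eq_sym.
  by rewrite (sum_delta (fun l => b (n.+1 + l)%N)) ltnW // addSn addnS.
pose f := mulmxr (map_mx Num.conj A) \o mulmx A^T.
pose Y n := (u n)^T *m map_mx Num.conj (u n).
have YA n : mxvec (Y n) = mxvec (Y n.+1) *m lin_mx f.
  rewrite mul_vec_lin /f /= /Y {1 2}uA trmx_mul map_mxM /=.
  by rewrite !mulmxA.
have e n : mxvec (Y n) 0 (mxvec_index ord0 ord0) = `|b n| ^+ 2.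
  by rewrite mxvecE mxE big_ord1 !mxE addn0 normCK.
rewrite -e; apply: (@backward_geometric _ _ (lin_mx f) (fun n => mxvec (Y n)) _ c t t0 YA) => n.
by rewrite e.
Qed.

End ProductRecurrence.

Section Rigidity.
Variables (C : numClosedFieldType) (a : nat -> C) (t : C).
Hypothesis Ta : toeplitz_contraction a.
Hypothesis t01 : 0 < t < 1.
Hypothesis a_geo : forall k, `|a k| ^+ 2 = (1 - t) * t ^+ k.
(* This is the convergence of [t ^+ n] to 0, for an abstract field [C]. *)
Hypothesis t_null : forall x K : C, 0 <= K -> (forall n, x <= K * t ^+ n) -> x <= 0.

Let t_gt0 : 0 < t. Proof. by case/andP: t01. Qed.
Let t_ge0 : 0 <= t. Proof. exact: ltW. Qed.
Let t_lt1 : t < 1. Proof. by case/andP: t01. Qed.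

Lemma sum_norm_geometric n : \sum_(k < n) `|a k| ^+ 2 = 1 - t ^+ n.
Proof.
under eq_bigr do rewrite a_geo.
by rewrite -mulr_sumr -[RHS]opprB subrX1 -mulNr opprB.
Qed.

Lemma norm_geometric_le1 k : `|a k| <= 1.
Proof.
rewrite -[leRHS]/1 -(@ler_pXn2r _ 2) ?nnegrE // expr1n a_geo.
rewrite mulr_ile1 ?subr_ge0 ?exprn_ge0 ?(ltW t_lt1) //.
  by rewrite lerBlDr lerDl.
by rewrite exprn_ile1 // ltW.
Qed.

(** The two diagonal sums of the two-term inequality already exhaust its right
    side up to [O(t ^+ n)], which leaves no room for the cross term when [c] is
    the phase that makes it positive. *)
Lemma autocorrelation m n : (0 < m)%N ->
  `|\sum_(k < n) a (m + k)%N * (a k)^*| <= t ^+ n.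
Proof.
move=> m0; case: n => [|n]; first by rewrite big_ord0 normr0 ler01.
set S := \sum_(k < _) _.
have [->|S0] := eqVneq S 0; first by rewrite normr0 exprn_ge0.
have [c nc cS] : exists2 c : C, `|c| = 1 & c^* * S = `|S|.
  exists (S / `|S|); first by rewrite normrM normfV normr_id divff // normr_eq0.
  rewrite rmorphM fmorphV /= [(`|S|)^*]conj_Creal ?normr_real //.
  by rewrite mulrAC [_^* * _]mulrC -normCK expr2 mulfK // normr_eq0.
have := @toeplitz_two_term _ _ Ta c m n.+1 m0 isT.
rewrite nc expr1n sum_norm_geometric.
have -> : \sum_(k < n.+1) `|a (m + k)%N + c * a k| ^+ 2
   = t ^+ m * (1 - t ^+ n.+1) + (1 - t ^+ n.+1) + `|S| + `|S|.
  transitivity (\sum_(k < n.+1) (t ^+ m * `|a k| ^+ 2 + `|a k| ^+ 2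
     + c^* * (a (m + k)%N * (a k)^*) + (c^* * (a (m + k)%N * (a k)^*))^*)).
    apply: eq_bigr => k _.
    have -> : t ^+ m * `|a k| ^+ 2 = `|a (m + k)%N| ^+ 2.
      by rewrite !a_geo exprD mulrCA.
    rewrite !normCK !rmorphM !rmorphD !rmorphM /= !conjCK.
    have : c * c^* = 1 by rewrite -normCK nc expr1n.
    move: (a (m + k)%N) (a k) (c^*) => x y d cd.
    transitivity (c * d * (y * y^*) + y^* * d * x + x * x^* + c * y * x^*).
      by ring.
    by rewrite cd; ring.
  rewrite !big_split /= -rmorph_sum -!mulr_sumr !sum_norm_geometric -/S.
  by rewrite cS /= conj_Creal ?normr_real.
have tn0 : 0 <= t ^+ n.+1 by rewrite exprn_ge0.
have tm1 : t ^+ m <= 1 by rewrite exprn_ile1 // ltW.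
move=> h.
rewrite -(@ler_pM2l _ 2) //.
have : t ^+ m * t ^+ n.+1 <= 1 * t ^+ n.+1 by rewrite ler_wpM2r.
move=> h1; rewrite -subr_ge0 in h; rewrite -subr_ge0 in h1.
rewrite -subr_ge0; apply: (le_trans (addr_ge0 h h1)).
by rewrite le_eqVlt; apply/orP; left; apply/eqP; ring.
Qed.

(** Entry [k] of an element of the span of the first [N] backward shifts
    [(a (k + n))_k], [1 <= n <= N]. *)
Definition shift_comb N (b : 'rV[C]_N) k := \sum_(i < N) b 0 i * a (k + i.+1)%N.

(** By [autocorrelation], an element [w] of the span is orthogonal to all forward
    shifts of [a], up to [O(t ^+ n)] after truncation.  In the adjoint
    contraction property for [w + s e_k] the left side is therefore about
    [`|s| ^+ 2 * \sum_(l <= k) `|a l| ^+ 2 = `|s| ^+ 2 * (1 - t ^+ k.+1)]; the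
    inequality follows for the best [s]. *)
Lemma shift_comb_bessel_trunc N (b : 'rV[C]_N) k :
  exists2 K : C, 0 <= K & forall n,
    `|shift_comb b k| ^+ 2 <=
     t ^+ k.+1 * (\sum_(j < k.+1 + n) `|shift_comb b j| ^+ 2 + K * t ^+ n).
Proof.
set w := shift_comb b; set T := t ^+ k.+1.
have T0 : 0 < T by rewrite exprn_gt0.
pose s := - w k / T; pose B := \sum_(i < N) `|b 0 i|.
have B0 : 0 <= B by rewrite sumr_ge0.
exists (\sum_(l < k.+1) 2 * B * `|s|).
  by rewrite sumr_ge0 // => i _; rewrite !mulr_ge0.
move=> n; set M := (k.+1 + n)%N.
(* The inner product of the truncated [w] with the forward shift of order [l]. *)
pose E l := \sum_(j < M | (l <= j)%N) (a (j - l)%N)^* * w j.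
have EB (l : 'I_k.+1) : `|E l| <= B * t ^+ n.
  have lM : (l <= M)%N by have := ltn_ord l; rewrite /M; lia.
  rewrite /E (sum_ord_shift (fun j => (a (j - l)%N)^* * w j)) //.
  have -> : \sum_(j < M - l) (a (l + j - l)%N)^* * w (l + j)%N =
     \sum_(i < N) b 0 i * \sum_(j < M - l) a (l + i.+1 + j)%N * (a j)^*.
    under eq_bigr do rewrite addKn /w /shift_comb mulr_sumr.
    rewrite exchange_big /=; apply: eq_bigr => i _; rewrite mulr_sumr.
    by apply: eq_bigr => j _; rewrite mulrCA addnAC [_^* * _]mulrC.
  apply: le_trans (ler_norm_sum _ _ _) _; rewrite mulr_suml; apply: ler_sum => i _.
  rewrite normrM ler_wpM2l //.
  apply: (le_trans (autocorrelation _ _)); first by lia.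
  rewrite ler_wiXn2l ?(ltW t_lt1) // /M; have := ltn_ord l; lia.
have := toeplitz_adjoint Ta M (fun j => w j + s * (j == k)%:R).
have -> : \sum_(j < M) `|w j + s * (j == k :> nat)%:R| ^+ 2
  = \sum_(j < M) `|w j| ^+ 2 + (`|w k + s| ^+ 2 - `|w k| ^+ 2).
  transitivity (\sum_(j < M)
    (`|w j| ^+ 2 + (`|w k + s| ^+ 2 - `|w k| ^+ 2) * (j == k :> nat)%:R)).
    apply: eq_bigr => j _; case: eqP => [->|_]; first by rewrite !mulr1; ring.
    by rewrite !mulr0 !addr0.
  rewrite big_split /= (sum_delta (fun=> `|w k + s| ^+ 2 - `|w k| ^+ 2)).
  by have -> : (k < M)%N by rewrite /M; lia.
move=> h.
have lo : \sum_(l < k.+1) (`|s| ^+ 2 * `|a (k - l)%N| ^+ 2 - 2 * B * `|s| * t ^+ n) <=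
  \sum_(l < M) `|\sum_(j < M | (l <= j)%N) (a (j - l)%N)^* * (w j + s * (j == k :> nat)%:R)| ^+ 2.
  rewrite /M big_split_ord /= -/M -[leLHS]addr0 lerD //; last first.
    by rewrite sumr_ge0 // => i _; rewrite exprn_ge0.
  apply: ler_sum => l _.
  have -> : \sum_(j < M | (l <= j)%N) (a (j - l)%N)^* * (w j + s * (j == k :> nat)%:R)
     = E l + s * (a (k - l)%N)^*.
    under eq_bigr do rewrite mulrDr mulrA.
    rewrite big_split /= -/(E l); congr (_ + _).
    rewrite big_mkcond /=.
    transitivity (\sum_(i < M)
      ((if (l <= i)%N then (a (i - l)%N)^* * s else 0) * (i == k :> nat)%:R)).
      by apply: eq_bigr => i _; case: ifP => _; rewrite ?mul0r.
    rewrite (sum_delta (fun i => if (l <= i)%N then (a (i - l)%N)^* * s else 0)).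
    have -> : (k < M)%N by rewrite /M; lia.
    by rewrite -ltnS ltn_ord mulrC.
  apply: le_trans (sqr_normD_ge _ _).
  have -> : `|s * (a (k - l)%N)^*| = `|s| * `|a (k - l)%N| by rewrite normrM norm_conjC.
  rewrite exprMn lerB //.
  have h1 : 2 * `|E l| * (`|s| * `|a (k - l)%N|) <= 2 * (B * t ^+ n) * (`|s| * 1).
    by rewrite ler_pM ?mulr_ge0 // ?ler_wpM2l ?norm_geometric_le1.
  by apply: (le_trans h1); rewrite le_eqVlt; apply/orP; left; apply/eqP; ring.
have := le_trans lo h.
rewrite sumrB -mulr_sumr.
have -> : \sum_(l < k.+1) `|a (k - l)%N| ^+ 2 = 1 - T.
  rewrite -sum_norm_geometric [RHS](reindex_inj rev_ord_inj) /=.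
  by apply: eq_bigr => l _; rewrite subSS.
rewrite -mulr_suml.
have ns : `|s| ^+ 2 = `|w k| ^+ 2 / T ^+ 2.
  by rewrite normrM normfV normrN (ger0_norm (ltW T0)) exprMn exprVn.
have -> : `|w k + s| ^+ 2 = `|w k| ^+ 2 - 2 * `|w k| ^+ 2 / T + `|w k| ^+ 2 / T ^+ 2.
  have -> : w k + s = w k * (1 - T^-1) by rewrite /s; ring.
  have r1 : `|1 - T^-1| ^+ 2 = (1 - T^-1) ^+ 2.
    by rewrite real_normK // rpredB ?rpred1 // realV gtr0_real.
  rewrite normrM exprMn r1.
  by rewrite sqrrB expr1n mul1r exprVn; ring.
rewrite ns.
move: (`|w k| ^+ 2) (\sum_(j < M) _) (\sum_(l < _) _) => X W K.
rewrite -subr_ge0 => g; rewrite mulrC -ler_pdivrMr // -subr_ge0.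
suff <- : W + (X - 2 * X / T + X / T ^+ 2 - X) - (X / T ^+ 2 * (1 - T) - K * t ^+ n)
  = W + K * t ^+ n - X / T by [].
by field; rewrite gt_eqF.
Qed.

Definition shift_col N k : 'cV[C]_N := \col_i a (k + i.+1)%N.

Definition gram_trunc N M : 'M[C]_N :=
  \matrix_(i, j) \sum_(k < M) a (k + i.+1)%N * (a (k + j.+1)%N)^*.

(** The inner product of two backward shifts is an autocorrelation of [a] from
    which finitely many terms have been removed. *)
Lemma gram_limit N : exists G : 'M[C]_N,
  forall M i j, `|gram_trunc N M i j - G i j| <= t ^+ M.
Proof.
pose g (i j : nat) : C := (i == j)%:R - \sum_(l < j.+1) a (i - j + l)%N * (a l)^*.
have low M (i j : nat) : (j <= i)%N ->
    `|\sum_(k < M) a (k + i.+1)%N * (a (k + j.+1)%N)^* - g i j| <= t ^+ M.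
  move=> ji; rewrite /g opprB addrCA addrA.
  have -> : \sum_(l < j.+1) a (i - j + l)%N * (a l)^* +
      \sum_(k < M) a (k + i.+1)%N * (a (k + j.+1)%N)^* =
      \sum_(l < j.+1 + M) a (i - j + l)%N * (a l)^*.
    rewrite big_split_ord /=; congr (_ + _); apply: eq_bigr => k _.
    by congr (a _ * (a _)^*); lia.
  apply: (@le_trans _ _ (t ^+ (j.+1 + M))); last first.
    by rewrite ler_wiXn2l ?(ltW t_lt1) // leq_addl.
  have [->|nij] := eqVneq i j.
    under eq_bigr do rewrite subnn add0n -normCK.
    by rewrite sum_norm_geometric addrAC subrr add0r normrN ger0_norm // exprn_ge0.
  rewrite subr0; apply: autocorrelation; lia.
exists (\matrix_(i, j) if (j <= i)%N then g i j else (g j i)^*) => M i j.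
rewrite !mxE; case: leqP => [|/ltnW ij]; first exact: low.
rewrite -norm_conjC rmorphB /= conjCK; apply: le_trans (low M _ _ ij).
rewrite le_eqVlt; apply/orP; left; apply/eqP; congr (`|_ - _|).
by rewrite rmorph_sum; apply: eq_bigr => k _; rewrite rmorphM /= conjCK mulrC.
Qed.

Lemma shift_combE N (b : 'rV[C]_N) k : (b *m shift_col N k) 0 0 = shift_comb b k.
Proof. by rewrite mxE; apply: eq_bigr => i _; rewrite mxE. Qed.

Definition hermitian_form N (G : 'M[C]_N) (b : 'rV[C]_N) := (b *m G *m (map_mx Num.conj b)^T) 0 0.

Lemma hermitian_formE N (G : 'M[C]_N) b : hermitian_form G b = \sum_i \sum_j b 0 i * G i j * (b 0 j)^*.
Proof.
rewrite /hermitian_form mxE; under eq_bigr do rewrite !mxE mulr_suml.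
by rewrite exchange_big.
Qed.

Lemma hermitian_form_gram_trunc N (b : 'rV[C]_N) M :
  hermitian_form (gram_trunc N M) b = \sum_(k < M) `|shift_comb b k| ^+ 2.
Proof.
rewrite hermitian_formE; under [RHS]eq_bigr do rewrite normCK /shift_comb rmorph_sum.
transitivity (\sum_i \sum_j \sum_(k < M)
   b 0 i * a (k + i.+1)%N * (b 0 j * a (k + j.+1)%N)^*).
  apply: eq_bigr => i _; apply: eq_bigr => j _.
  rewrite mxE mulr_sumr mulr_suml; apply: eq_bigr => k _.
  by rewrite rmorphM /=; ring.
under [LHS]eq_bigr do rewrite exchange_big /=.
rewrite exchange_big /=; apply: eq_bigr => k _; rewrite mulr_suml.
by apply: eq_bigr => i _; rewrite mulr_sumr.
Qed.

Section Gram.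
Variables (N : nat) (G : 'M[C]_N).
Hypothesis GP : forall M i j, `|gram_trunc N M i j - G i j| <= t ^+ M.

Lemma hermitian_form_gram_close (b : 'rV[C]_N) : exists2 K : C, 0 <= K &
  forall M, `|\sum_(k < M) `|shift_comb b k| ^+ 2 - hermitian_form G b| <= K * t ^+ M.
Proof.
exists (\sum_i \sum_j `|b 0 i| * `|b 0 j|).
  by rewrite !sumr_ge0 // => i _; rewrite sumr_ge0 // => j _; rewrite mulr_ge0.
move=> M; rewrite -hermitian_form_gram_trunc !hermitian_formE -sumrB mulr_suml.
apply: le_trans (ler_norm_sum _ _ _) (ler_sum _ _) => i _.
rewrite -sumrB mulr_suml.
apply: le_trans (ler_norm_sum _ _ _) (ler_sum _ _) => j _.
rewrite -mulrBl -mulrBr !normrM norm_conjC mulrAC.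
by rewrite ler_wpM2l ?mulr_ge0.
Qed.

Lemma shift_comb_bessel (b : 'rV[C]_N) k :
  `|shift_comb b k| ^+ 2 <= t ^+ k.+1 * hermitian_form G b.
Proof.
have [K1 K10 H1] := shift_comb_bessel_trunc b k.
have [K2 K20 H2] := hermitian_form_gram_close b.
have q_real : hermitian_form G b \is Num.real.
  rewrite CrealE -subr_eq0 -normr_le0; apply: (t_null (K := K2 + K2)) => [|M].
    by rewrite addr_ge0.
  set q := hermitian_form G b in H2 *; have := H2 M; set W := \sum_(k < M) _ => h.
  have -> : q^* - q = (q - W)^* + (W - q).
    rewrite rmorphB /= [W^*]conj_Creal; first by ring.
    by rewrite rpred_sum // => i _; rewrite ger0_real ?exprn_ge0.
  rewrite mulrDl; apply: le_trans (ler_normD _ _) (lerD _ h).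
  by rewrite norm_conjC distrC.
rewrite -subr_le0.
apply: (t_null (K := t ^+ k.+1 * (K1 + K2))) => [|M].
  by rewrite mulr_ge0 ?exprn_ge0 ?addr_ge0.
rewrite lerBlDr; apply: (le_trans (H1 M)).
rewrite -!mulrA -mulrDr ler_wpM2l ?exprn_ge0 //.
rewrite mulrDl -addrA [leLHS]addrC lerD2l -lerBlDr.
have := H2 (k.+1 + M)%N; set W := \sum_(j < _) _ => h.
apply: le_trans (real_ler_norm _) (le_trans h _).
  by rewrite rpredB // rpred_sum // => i _; rewrite ger0_real ?exprn_ge0.
by rewrite ler_wpM2l // ler_wiXn2l ?(ltW t_lt1) // leq_addl.
Qed.

(** The number [s k] is the squared norm of the projection of [e_k] to the span,
    which is at most [t ^+ k.+1] by [shift_comb_bessel].  The sum of the [s k] is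
    the trace of [invmx G *m G], that is [N]. *)
Lemma gram_unit_size : G \in unitmx -> N%:R <= t / (1 - t).
Proof.
move=> Gu; rewrite -subr_le0.
pose z k := (map_mx Num.conj (shift_col N k))^T *m invmx G.
pose s k := (z k *m shift_col N k) 0 0.
have sB k : `|s k| <= t ^+ k.+1.
  have := shift_comb_bessel (z k) k.
  have -> : hermitian_form G (z k) = (s k)^*.
    by rewrite /hermitian_form {1}/z mulmxKV // -trmx_mul -map_mxM mxE mxE.
  rewrite -shift_combE -/(s k) => h.
  have [->|s0] := eqVneq (s k) 0; first by rewrite normr0 exprn_ge0.
  rewrite -(@ler_pM2r _ `|s k|) ?normr_gt0 // -expr2.
  apply: (le_trans h); rewrite ler_wpM2l ?exprn_ge0 //.
  rewrite -[X in _ <= X]norm_conjC; apply: real_ler_norm; apply: ger0_real.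
  by rewrite -(pmulr_rge0 _ (exprn_gt0 k.+1 t_gt0)); apply: le_trans h; rewrite exprn_ge0.
apply: (t_null (K := \sum_i \sum_j `|invmx G i j|)) => [|M].
  by rewrite sumr_ge0 // => i _; rewrite sumr_ge0.
have tr : \sum_(k < M) s k = N%:R + \tr (invmx G *m (gram_trunc N M - G)).
  rewrite mulmxBr mulVmx // raddfB /= mxtrace1 addrC subrK.
  have -> : gram_trunc N M =
      \sum_(k < M) shift_col N k *m (map_mx Num.conj (shift_col N k))^T.
    apply/matrixP => i j; rewrite summxE !mxE; apply: eq_bigr => k _.
    by rewrite mxE big_ord1 !mxE.
  rewrite mulmx_sumr raddf_sum /=; apply: eq_bigr => k _.
  by rewrite mulmxA mxtrace_mulC mulmxA -/(z k) /mxtrace big_ord1.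
have sS : \sum_(k < M) `|s k| <= t / (1 - t).
  apply: (@le_trans _ _ (\sum_(k < M) t ^+ k.+1)); first exact: ler_sum.
  rewrite ler_pdivlMr ?subr_gt0 //; under eq_bigr do rewrite exprS.
  rewrite -mulr_sumr -mulrA -[leRHS]mulr1 ler_wpM2l // mulrC -opprB mulNr -subrX1 opprB.
  by rewrite lerBlDr lerDl exprn_ge0.
have trB : `|\tr (invmx G *m (gram_trunc N M - G))| <=
   (\sum_i \sum_j `|invmx G i j|) * t ^+ M.
  rewrite /mxtrace mulr_suml; apply: le_trans (ler_norm_sum _ _ _) (ler_sum _ _) => i _.
  rewrite mxE mulr_suml; apply: le_trans (ler_norm_sum _ _ _) (ler_sum _ _) => j _.
  by rewrite normrM ler_wpM2l // !mxE; have := GP M j i; rewrite !mxE.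
rewrite lerBlDr addrC -[leLHS]normr_nat.
have -> : N%:R = \sum_(k < M) s k - \tr (invmx G *m (gram_trunc N M - G)) by rewrite tr addrK.
apply: le_trans (ler_normB _ _) (lerD _ trB).
exact: le_trans (ler_norm_sum _ _ _) sS.
Qed.

End Gram.

(** For large [N] the Gram matrix is singular, and by [shift_comb_bessel] a vector
    of its kernel gives the zero combination of the shifts. *)
Lemma exists_recurrence N : t / (1 - t) < N%:R ->
  exists2 b : 'rV[C]_N, b != 0 & forall k, shift_comb b k = 0.
Proof.
move=> tN; have [G GP] := gram_limit N.
have : G \notin unitmx.
  apply/negP => Gu; have := gram_unit_size GP Gu.
  by move=> /(lt_le_trans tN); rewrite ltxx.
rewrite -row_free_unit -kermx_eq0 => /rowV0Pn[b /sub_kermxP bG b0].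
exists b => // k; apply/eqP; rewrite -normr_eq0 -sqrf_eq0 eq_le exprn_ge0 // andbT.
have := shift_comb_bessel GP b k.
by rewrite /hermitian_form bG mul0mx mxE mulr0.
Qed.

(** The value at 0 is the one that the vanishing autocorrelations prescribe: for
    the inner function [f] with coefficients [a], it is [f 0 - f oo], where
    [f oo = 1 / (f 0)^*] by reflection. *)
Definition reflected n := if n is 0%N then - t / (a 0%N)^* else a n.
Local Notation b := reflected.

Lemma a0_neq0 : a 0%N != 0.
Proof.
rewrite -normr_eq0 -sqrf_eq0 a_geo expr0 mulr1 subr_eq0 eq_sym.
by rewrite lt_eqF.
Qed.

Lemma reflected_convolution n M :
  `|(a 0%N)^* * b n + \sum_(k < M) (a k.+1)^* * a (k.+1 + n)%N| <= t ^+ M.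
Proof.
apply: (@le_trans _ _ (t ^+ M.+1)); last by rewrite ler_wiXn2l // ltW.
case: n => [|n] /=.
  rewrite mulrC divfK ?conjC_eq0 ?a0_neq0 //.
  under eq_bigr do rewrite addn0 mulrC -normCK.
  have := sum_norm_geometric M.+1; rewrite big_ord_recl a_geo expr0 mulr1 /bump /= => h.
  have -> : \sum_(i < M) `|a i.+1| ^+ 2 = t - t ^+ M.+1.
    by apply: (addrI (1 - t)); rewrite h addrA subrK.
  by rewrite addKr normrN ger0_norm // exprn_ge0.
have := @autocorrelation n.+1 M.+1 isT.
rewrite big_ord_recl addn0 mulrC /bump /=.
by congr (`|_ + _| <= _); apply: eq_bigr => k _; rewrite mulrC addnC.
Qed.

(** [reflected_convolution] expresses the term of index [m + j] by later terms
    with coefficients that do not depend on [j], so the recurrence at [m] is a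
    combination of the recurrences at larger indices. *)
Lemma recurrence_extends (g : nat -> C) D m :
  (forall k, (m < k)%N -> \sum_(j < D) g j * b (k + j)%N = 0) ->
  \sum_(j < D) g j * b (m + j)%N = 0.
Proof.
move=> rec; apply/(@mulfI _ (a 0%N)^*); first by rewrite conjC_eq0 a0_neq0.
rewrite mulr0; apply/eqP; rewrite -normr_le0.
apply: (t_null (K := \sum_(j < D) `|g j|)) => [|M]; first exact: sumr_ge0.
have -> : (a 0%N)^* * (\sum_(j < D) g j * b (m + j)%N) =
  \sum_(j < D) g j * ((a 0%N)^* * b (m + j)%N +
         \sum_(k < M) (a k.+1)^* * a (k.+1 + (m + j))%N).
  under [RHS]eq_bigr do rewrite mulrDr mulrCA mulr_sumr.
  rewrite big_split /= -mulr_sumr exchange_big /= [X in _ = _ + X]big1 ?addr0 // => k _.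
  under eq_bigr do rewrite mulrCA.
  rewrite -mulr_sumr; have := rec (k.+1 + m)%N; rewrite addSn ltnS leq_addl => /(_ isT).
  by under eq_bigr do rewrite addSn -addnA /=; move=> ->; rewrite mulr0.
apply: le_trans (ler_norm_sum _ _ _) _; rewrite mulr_suml; apply: ler_sum => j _.
by rewrite normrM ler_wpM2l // reflected_convolution.
Qed.

Lemma geometric_moduli_impossible N : t / (1 - t) < N%:R -> 1 < 2 * t -> False.
Proof.
move=> tN t2; have [beta beta0 rec] := exists_recurrence tN.
pose g (i : nat) : C := oapp (beta 0) 0 (insub i).
have gE (i : 'I_N) : g i = beta 0 i by rewrite /g valK.
have gN i : (N <= i)%N -> g i = 0 by move=> Ni; rewrite /g insubN // -leqNgt.
have exg : exists i, g i != 0.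
  have /rV0Pn[i bi] := beta0; by exists i; rewrite gE.
(* The coefficient of least index has to be nonzero to run the recurrence
   backwards; [m] is the index of the first nonzero one. *)
case: (ex_minnP exg) => m gm minm.
have below i : (i < m)%N -> g i = 0.
  by move=> im; apply/eqP; apply: contraTT im => /minm; rewrite leqNgt.
have rec0 k : (m < k)%N -> \sum_(j < N.+2) g (m + j)%N * b (k + j)%N = 0.
  move=> mk; apply: etrans (rec (k - m).-1); rewrite /shift_comb.
  transitivity (\sum_(i < m + N.+2) g i * b (k - m + i)%N).
    rewrite big_split_ord /= [X in _ = X + _]big1 ?add0r => [|i _]; last by rewrite below ?mul0r.
    by apply: eq_bigr => j _; congr (_ * b _); lia.
  rewrite (_ : (m + N.+2 = N + m.+2)%N); last by lia.
  rewrite big_split_ord /= [X in _ + X]big1 ?addr0 => [|i _]; last first.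
    by rewrite gN ?mul0r // leq_addr.
  apply: eq_bigr => i _; rewrite gE; congr (_ * _).
  rewrite (_ : (k - m + i = ((k - m).-1 + i).+1)%N) /=; last by lia.
  by rewrite addnS.
have recN k : \sum_(j < N.+2) g (m + j)%N * b (k + j)%N = 0.
  (* Descend from the indices larger than [m], one at a time. *)
  suff {k} H d : forall k, (m < k + d)%N -> \sum_(j < N.+2) g (m + j)%N * b (k + j)%N = 0.
    by apply: (H m.+1); rewrite addnS ltnS leq_addl.
  elim: d => [|d IH] k; first by rewrite addn0; apply: rec0.
  move=> mk; apply: (@recurrence_extends (fun j => g (m + j)%N)) => k' kk'.
  by apply: IH; lia.
have h := @recurrence_backward_norm _ b N (fun j => g (m + j)%N) (1 - t) t _ _ recN.
have : `|b 0%N| ^+ 2 = 1 - t.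
  apply: h => [|| n]; [by rewrite gt_eqF | by rewrite addn0 | exact: a_geo].
rewrite /= normrM normfV normrN norm_conjC exprMn exprVn a_geo expr0 mulr1 ger0_norm //.
have s0 : 1 - t != 0 by rewrite subr_eq0 eq_sym lt_eqF.
move=> /(congr1 (fun x => x * (1 - t))); rewrite divfK // => e.
have : (2 * t - 1) = 0.
  by transitivity (t ^+ 2 - (1 - t) * (1 - t)); [ring | rewrite e subrr].
by move/eqP; rewrite subr_eq0 gt_eqF.
Qed.

End Rigidity.

(** * Compactness *)

Section Compactness.
Variable R : realType.
Local Notation C := (Cplx R).
Local Notation toC := (fun x : R => (x%:C)%C : C).
Local Notation normc := (@ComplexField.Normc.normc R).

(** Limits along an ultrafilter converge in all coordinates simultaneously, which
    replaces the extraction of a diagonal subsequence. *)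
Lemma ultra_cvg_bounded (U : set_system nat) (g : nat -> R) : UltraFilter U ->
  (forall j, `|g j| <= 1) -> exists l : R, g j @[j --> U] --> l.
Proof.
move=> UU g1; have UP : ProperFilter U by exact: ultra_proper.
have gU : (g @ U) `[-1, 1]%classic.
  by apply: nearW => j; rewrite /= in_itv /= -ler_norml.
have [l [_ cl]] := @segment_compact R (-1) 1 (g @ U) _ gU.
exists l => B Bl.
have [//|nB] := in_ultra_setVsetC (g @^-1` B) UU.
by have [y [/= ny yB]] := cl (~` B) B nB Bl.
Qed.

Lemma norm_complex_le (z : C) :
  `|z| <= (`|complex.Re z|%:C + `|complex.Im z|%:C)%C.
Proof.
have nr (r : R) : `|(r%:C)%C : C| = (`|r|%:C)%C.
  by rewrite norm_normc /= expr0n addr0 sqrtr_sqr.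
rewrite {1}(complexE z); apply: le_trans (ler_normD _ _) _.
by rewrite normrM nr [`|'i%C|](@normCi C) mul1r nr.
Qed.

Lemma cvg_complex (U : set_system nat) (z : nat -> C) (x y : R) : Filter U ->
  complex.Re (z j) @[j --> U] --> x -> complex.Im (z j) @[j --> U] --> y ->
  z j @[j --> U] --> ((x +i* y)%C : C).
Proof.
move=> FU cx cy; apply/cvgrPdist_lt => e e0.
have er := ge0_Re (ltW e0).
have e0' : 0 < complex.Re e / 2 by rewrite divr_gt0 // -ltcR -er.
move/cvgrPdist_lt : cx => /(_ _ e0') cx.
move/cvgrPdist_lt : cy => /(_ _ e0') cy.
near=> j; apply: le_lt_trans (norm_complex_le _) _.
rewrite er -rmorphD /= ltcR [ltRHS]splitr; apply: ltrD.
  have -> : complex.Re ((x +i* y)%C - z j) = x - complex.Re (z j) by case: (z j).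
  by near: j.
have -> : complex.Im ((x +i* y)%C - z j) = y - complex.Im (z j) by case: (z j).
by near: j.
Unshelve. all: by end_near.
Qed.

Lemma cvg_sum_ord (U : set_system nat) n (g : 'I_n -> nat -> C) (l : 'I_n -> C) : Filter U ->
  (forall i, g i j @[j --> U] --> l i) ->
  \sum_(i < n) g i j @[j --> U] --> \sum_(i < n) l i.
Proof.
move=> FU; elim: n g l => [|n IH] g l gl.
  rewrite big_ord0; under eq_fun do rewrite big_ord0; exact: cvg_cst.
rewrite big_ord_recr; under eq_fun do rewrite big_ord_recr.
by apply: cvgD; [apply: IH|].
Qed.

(** A complex number is nonnegative when it is equal to its norm, and the norm is
    continuous. *)
Lemma cvg_ge0 (U : set_system nat) (g : nat -> C) (l : C) : ProperFilter U ->
  g j @[j --> U] --> l -> (forall j, 0 <= g j) -> 0 <= l.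
Proof.
move=> PU gl g0; have ngl : `|g j| @[j --> U] --> `|l| by apply: cvg_norm.
rewrite (_ : (fun x => `|g x|) = g) in ngl; last by apply/funext => j; rewrite ger0_norm.
by rewrite (norm_cvg_unique gl ngl).
Qed.

Lemma contraction_limit (U : set_system nat) (A : nat -> nat -> C) (a : nat -> C) :
  ProperFilter U -> (forall k, A j k @[j --> U] --> a k) ->
  (forall j, toeplitz_contraction (A j)) -> toeplitz_contraction a.
Proof.
move=> PU Aa TA n x; rewrite -subr_ge0.
apply: (@cvg_ge0 U (fun j => \sum_(k < n) `|x k| ^+ 2 -
   \sum_(k < n) `|\sum_(l < k.+1) A j (k - l)%N * x l| ^+ 2)); last first.
  by move=> j; rewrite subr_ge0; exact: TA.
apply: cvgB; first exact: cvg_cst.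
apply: cvg_sum_ord => k; apply: cvgM; apply: cvg_norm; apply: cvg_sum_ord => l;
  by apply: cvgM => //; exact: cvg_cst.
Qed.

Lemma contraction_compact (v : nat -> R) :
  (forall d, 0 < d -> exists2 a : nat -> C, toeplitz_contraction a &
     forall k, `|normc (a k) - v k| <= d) ->
  exists2 a : nat -> C, toeplitz_contraction a & forall k, normc (a k) = v k.
Proof.
move=> H.
have /choice[A HA] : forall j : nat, exists a : nat -> C, toeplitz_contraction a /\
    forall k, `|normc (a k) - v k| <= j.+1%:R^-1.
  by move=> j; have [|a Ta Da] := H j.+1%:R^-1; [rewrite invr_gt0 | exists a].
have [U [UU sU]] := ultraFilterLemma (eventually_filter).
have PU : ProperFilter U by exact: ultra_proper.
have A1 j k : normc (A j k) <= 1.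
  have := contraction_sum_normc k.+1 (HA j).1; rewrite big_ord_recr /= => h.
  rewrite -(@ler_pXn2r _ 2) ?nnegrE ?normc_ge0 // expr1n; apply: le_trans h.
  by rewrite lerDr sumr_ge0 // => i _; rewrite exprn_ge0 // normc_ge0.
have Re1 j k : `|complex.Re (A j k)| <= 1.
  apply: le_trans (A1 j k); case: (A j k) => x y /=.
  by rewrite -sqrtr_sqr ler_wsqrtr // lerDl sqr_ge0.
have Im1 j k : `|complex.Im (A j k)| <= 1.
  apply: le_trans (A1 j k); case: (A j k) => x y /=.
  by rewrite -sqrtr_sqr ler_wsqrtr // lerDr sqr_ge0.
have /choice[x xP] : forall k, exists l : R, complex.Re (A j k) @[j --> U] --> l.
  by move=> k; apply: ultra_cvg_bounded.
have /choice[y yP] : forall k, exists l : R, complex.Im (A j k) @[j --> U] --> l.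
  by move=> k; apply: ultra_cvg_bounded.
pose a k : C := (x k +i* y k)%C.
have Aa k : A j k @[j --> U] --> a k by apply: cvg_complex.
exists a; first exact: (contraction_limit PU Aa (fun j => (HA j).1)).
move=> k; apply/eqP; rewrite eq_sym; apply/eqP; apply: complexI; rewrite -norm_normc.
have nAa : `|A j k| @[j --> U] --> `|a k| by apply: cvg_norm.
apply: (norm_cvg_unique _ nAa); apply/cvgrPdist_lt => e e0.
have er := ge0_Re (ltW e0).
have e0' : 0 < complex.Re e by rewrite -ltcR -er.
apply: sU; have := near_infty_natSinv_lt (PosNum e0').
apply: filterS => j /= hj.
rewrite [`|A j k|]norm_normc -rmorphB norm_normc /= expr0n addr0 sqrtr_sqr er ltcR distrC.
exact: le_lt_trans ((HA j).2 k) hj.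
Qed.

(** Otherwise [contraction_compact] would give a Toeplitz contraction excluded by
    [geometric_moduli_impossible]. *)
Lemma contraction_gap (t : R) : 1 / 2 < t < 1 ->
  exists2 d : R, 0 < d & forall a : nat -> C, toeplitz_contraction a ->
    exists k, d < `|normc (a k) - Num.sqrt ((1 - t) * t ^+ k)|.
Proof.
move=> /andP[t2 t1]; apply: contrapT => nogap.
have t0 : 0 < t by lra.
have [|a Ta av] := @contraction_compact (fun k => Num.sqrt ((1 - t) * t ^+ k)).
  move=> d d0; apply: contrapT => H; apply: nogap; exists d => // a Ta.
  apply: contrapT => H2; apply: H; exists a => // k.
  by rewrite leNgt; apply/negP => dk; apply: H2; exists k.
have T01 : 0 < toC t < 1.
  by rewrite -[0]/(toC 0) -[1]/(toC 1) !ltcR t0.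
have a_geo k : `|a k| ^+ 2 = (1 - toC t) * toC t ^+ k.
  rewrite norm_sqrE av sqr_sqrtr ?mulr_ge0 ?exprn_ge0 ?subr_ge0 ?(ltW t1) ?(ltW t0) //.
  by rewrite rmorphM rmorphB rmorph1 rmorphXn.
have T01' : 0 <= toC t < 1 by case/andP: T01 => /ltW -> ->.
have q0 : 0 <= t / (1 - t) by rewrite divr_ge0 ?subr_ge0 ?(ltW t0) ?(ltW t1).
have tN : toC t / (1 - toC t) < (Num.bound (t / (1 - t)))%:R.
  rewrite -[1]/(toC 1) -(rmorph_nat (real_complex R)) -rmorphB -fmorphV -rmorphM ltcR.
  exact: archi_boundP.
apply: (geometric_moduli_impossible Ta T01 a_geo _ tN).
  by move=> x K; exact: geometric_null.
by rewrite -[1]/(toC 1) -(rmorph_nat (real_complex R)) -rmorphM ltcR; lra.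
Qed.

End Compactness.

(** * Estimates for powered sums *)

(** Summation by parts, in the form of an induction: the slack of the weighted
    inequality is at least [rho ^+ m] times the slack of the hypothesis. *)
Lemma weighted_tail_bound (R : realFieldType) (s : nat -> R) (D rho : R) n :
  0 <= D <= 1 -> 0 <= rho <= 1 -> (forall k, 0 <= s k) ->
  (forall m, D * (\sum_(k < m) s k) + s m <= D ^+ 2) ->
  (1 - rho * (1 - D)) * \sum_(k < n) s k * rho ^+ k <= D ^+ 2.
Proof.
move=> /andP[D0 D1] /andP[r0 r1] s0 H.
pose S m := \sum_(k < m) s k * rho ^+ k; pose A m := \sum_(k < m) s k.
have SS m : S m.+1 = S m + s m * rho ^+ m by rewrite /S big_ord_recr.
have AS m : A m.+1 = A m + s m by rewrite /A big_ord_recr.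
have G0 m : 0 <= D ^+ 2 - D * A m - s m by rewrite -addrA -opprD subr_ge0; exact: H.
have key m : rho ^+ m * (D ^+ 2 - D * A m - s m) <= D ^+ 2 + (1 - D) * rho * S m - S m.+1.
  elim: m => [|m IH].
    by rewrite SS /S /A !big_ord0 !mulr0 expr0; lra.
  rewrite (SS m.+1) [S m.+1 in X in _ <= X - _](SS m) AS exprS.
  have h : rho * (rho ^+ m * (D ^+ 2 - D * A m - s m)) <= rho ^+ m * (D ^+ 2 - D * A m - s m).
    by rewrite ler_piMl // mulr_ge0 // exprn_ge0.
  have := le_trans h IH; rewrite (SS m).
  move: (rho ^+ m) (A m) (S m) (s m) (s m.+1) => P a b c d; nra.
have : 0 <= D ^+ 2 + (1 - D) * rho * S n - S n.+1.
  by apply: le_trans (key n); rewrite mulr_ge0 ?exprn_ge0.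
have := mulr_ge0 (s0 n) (exprn_ge0 n r0).
rewrite SS -/(S n); move: (s n * _) (S n) => x y; nra.
Qed.

Section PoweredSums.
Variable R : realType.

Lemma powR_bernoulli (q x : R) : 0 < q <= 1 -> 0 <= x -> x `^ q <= 1 + q * (x - 1).
Proof.
move=> /andP[q0]; rewrite le_eqVlt => /predU1P[-> x0|q1 x0]; first by rewrite powRr1 //; lra.
have iq : 0 < (1 - q)^-1 by rewrite invr_gt0 subr_gt0.
have := @conjugate_powR R (x `^ q) 1 q^-1 (1 - q)^-1 (powR_ge0 _ _) ler01.
rewrite !invrK invr_gt0 => /(_ q0 iq); rewrite addrC subrK => /(_ erefl).
by rewrite mulr1 powR1 -powRrM divff ?gt_eqF // powRr1 //; lra.
Qed.

Lemma powRD2 (x y : R) : 0 < x -> x `^ (y - 2) * x ^+ 2 = x `^ y.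
Proof.
move=> x0; rewrite -[x ^+ 2]powR_mulrn ?(ltW x0) // -powRD ?subrK //.
by rewrite (gt_eqF x0) implybT.
Qed.

(** The tangent to [x `^ q] at [x = v ^+ 2].  Bernoulli's inequality is applied to
    [(u / v) `^ q] and then squared; the quadratic term that this leaves measures
    the distance from equality. *)
Lemma powR_tangent (q u v : R) : 0 < q <= 1 -> 0 <= u -> 0 < v ->
  u `^ (2 * q) <= v `^ (2 * q - 2) *
    (v ^+ 2 + q * (u ^+ 2 - v ^+ 2) - q * (1 - q) * (u - v) ^+ 2).
Proof.
move=> q01 u0 v0; have x0 : 0 <= u / v by rewrite divr_ge0 // ltW.
have := powR_bernoulli q01 x0; set x := u / v => h.
have ux : u = v * x by rewrite /x mulrC divfK // gt_eqF.
rewrite [u in leLHS]ux powRM ?(ltW v0) //.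
rewrite -[v `^ (2 * q)]powRD2 // -mulrA ler_wpM2l ?powR_ge0 //.
have -> : x `^ (2 * q) = (x `^ q) ^+ 2.
  by rewrite mulrC powRrM powR_mulrn // powR_ge0.
have h2 : (x `^ q) ^+ 2 <= (1 + q * (x - 1)) ^+ 2.
  by rewrite ler_pXn2r ?nnegrE ?powR_ge0 // (le_trans _ h) ?powR_ge0.
apply: le_trans (ler_wpM2l (exprn_ge0 2 (ltW v0)) h2) _.
by rewrite {}ux le_eqVlt; apply/orP; left; apply/eqP; ring.
Qed.

(** Along a geometric sequence of points of contact the slopes, weighted by
    [r ^+ k], are geometric as well. *)
Lemma geometric_tangent (q r b c u : R) k : 0 < q <= 1 -> 0 <= r -> 0 < b -> 0 < c -> 0 <= u ->
  u `^ (2 * q) * r ^+ k <= c `^ (2 * q - 2) * (r * b `^ (2 * q - 2)) ^+ k *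
   ((c * b ^+ k) ^+ 2 + q * (u ^+ 2 - (c * b ^+ k) ^+ 2)
      - q * (1 - q) * (u - c * b ^+ k) ^+ 2).
Proof.
move=> q01 r0 b0 c0 u0.
have v0 : 0 < c * b ^+ k by rewrite mulr_gt0 // exprn_gt0.
apply: le_trans (ler_wpM2r (exprn_ge0 k r0) (powR_tangent q01 u0 v0)) _.
rewrite powRM ?(ltW c0) ?exprn_ge0 ?(ltW b0) // le_eqVlt; apply/orP; left; apply/eqP.
have -> : (b ^+ k) `^ (2 * q - 2) = (b `^ (2 * q - 2)) ^+ k.
  by rewrite -[b ^+ k]powR_mulrn ?(ltW b0) // powRAC powR_mulrn ?powR_ge0.
by rewrite [(r * _) ^+ k]exprMn; ring.
Qed.

Lemma geometric_sum_le (x : R) n : 0 <= x < 1 -> \sum_(k < n) x ^+ k <= (1 - x)^-1.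
Proof.
move=> /andP[x0 x1]; rewrite -[leRHS]div1r ler_pdivlMr ?subr_gt0 // mulrC.
by rewrite -opprB mulNr -subrX1 opprB lerBlDr lerDl exprn_ge0.
Qed.

(** Comparison with the automorphism whose value at 0 is [u 0].  The hypothesis
    [r * u 0 `^ (2 * q - 2) <= 1] is the condition [rho <= 1] of
    [weighted_tail_bound]. *)
Lemma powered_sum_bracket (q r : R) (u : nat -> R) n : 0 < q <= 1 -> 0 <= r -> (forall k, 0 <= u k) ->
  0 < u 0%N < 1 -> r * u 0%N `^ (2 * q - 2) <= 1 ->
  (forall m, (1 - u 0%N ^+ 2) * (\sum_(k < m) u k.+1 ^+ 2) + u m.+1 ^+ 2
       <= (1 - u 0%N ^+ 2) ^+ 2) ->
  \sum_(k < n) u k `^ (2 * q) * r ^+ k <= bohr_bracket (2 * q) r (u 0%N).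
Proof.
move=> q01 r0 u0 /andP[a0 a1] rho1 H.
set a := u 0%N in a0 a1 rho1 H *; set D := 1 - a ^+ 2 in H *.
set rho := r * a `^ (2 * q - 2) in rho1.
have [q0 q1] := andP q01.
have a2 : 0 < a ^+ 2 < 1 by rewrite exprn_gt0 // exprn_ilt1 // ltW.
have D0 : 0 < D by rewrite /D; lra.
have D1 : D <= 1 by rewrite /D; lra.
have rho0 : 0 <= rho by rewrite mulr_ge0 // powR_ge0.
have rhoa : rho * a ^+ 2 = r * a `^ (2 * q) by rewrite /rho -mulrA powRD2.
have ra : 0 <= rho * a ^+ 2 < 1.
  by rewrite mulr_ge0 ?exprn_ge0 ?(ltW a0) //=; apply: le_lt_trans (_ : 1 * a ^+ 2 < 1);
    [rewrite ler_wpM2r // ltW; case/andP: a2 | rewrite mul1r; case/andP: a2].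
have [_ ra1] := andP ra.
have den : 0 < 1 - rho * a ^+ 2 by rewrite subr_gt0.
rewrite /bohr_bracket -/a -/D -rhoa.
case: n => [|n].
  by rewrite big_ord0 addr_ge0 ?powR_ge0 // divr_ge0 ?(ltW den) // mulr_ge0 ?powR_ge0.
rewrite big_ord_recl expr0 mulr1 lerD2l.
pose W := D `^ (2 * q - 2).
have W0 : 0 <= W by rewrite powR_ge0.
apply: (@le_trans _ _ (r * W * ((1 - q) * (D ^+ 2 * \sum_(k < n) (rho * a ^+ 2) ^+ k)
    + q * \sum_(k < n) u k.+1 ^+ 2 * rho ^+ k))).
  rewrite !mulr_sumr -big_split /= mulr_sumr ler_sum // => k _.
  rewrite /bump /= [r ^+ _]exprS mulrCA -[r * W * _]mulrA ler_wpM2l //.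
  apply: le_trans (geometric_tangent _ q01 r0 a0 D0 (u0 _)) _; rewrite -/W -/rho -[leLHS]mulrA.
  have -> : (rho * a ^+ 2) ^+ k = rho ^+ k * (a ^+ k) ^+ 2.
    by rewrite exprMn -!exprM mulnC.
  rewrite ler_wpM2l //.
  have : 0 <= rho ^+ k * (q * (1 - q) * (u k.+1 - D * a ^+ k) ^+ 2).
    by rewrite mulr_ge0 ?exprn_ge0 // mulr_ge0 ?sqr_ge0 // mulr_ge0 ?subr_ge0 // ltW.
  move: (rho ^+ k) (u k.+1) (a ^+ k) => P x y h.
  rewrite -subr_ge0; apply: le_trans h _; rewrite le_eqVlt; apply/orP; left; apply/eqP; ring.
rewrite -mulrA -[r * _ / _]mulrA ler_wpM2l //.
have -> : D `^ (2 * q) = W * D ^+ 2 by rewrite /W powRD2.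
rewrite -mulrA ler_wpM2l //.
have g := geometric_sum_le n ra.
have w : \sum_(k < n) u k.+1 ^+ 2 * rho ^+ k <= D ^+ 2 / (1 - rho * a ^+ 2).
  rewrite ler_pdivlMr // mulrC.
  have := @weighted_tail_bound _ (fun k => u k.+1 ^+ 2) D rho n _ _ _ H.
  rewrite /D opprB addrCA subrr addr0; apply; rewrite ?rho0 ?(ltW D0) //.
  by move=> k; rewrite exprn_ge0.
have w2 : D ^+ 2 * \sum_(k < n) (rho * a ^+ 2) ^+ k <= D ^+ 2 / (1 - rho * a ^+ 2).
  by rewrite ler_wpM2l // exprn_ge0 // ltW.
move: (D ^+ 2 * _) (D ^+ 2 / _) (\sum_(k < n) _) w w2 => x y z zy xy; nra.
Qed.

(** Comparison with the automorphism whose value at 0 is [b = sqrt t].  All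
    tangents of index at least 1 have the same weighted slope [q * (r * W)], which
    is at most the slope [q * w0] at index 0 because [t <= 1 / 2]; as
    [u 0 ^+ 2 <= t], mass moved from the later indices to the index 0 can only
    increase the bound. *)
Lemma powered_sum_bracket_small (q r t : R) (u : nat -> R) n : 0 < q < 1 -> 0 < t <= 1 / 2 ->
  r = t `^ (1 - q) -> (forall k, 0 <= u k) ->
  (forall m, \sum_(k < m) u k ^+ 2 <= 1) -> u 0%N ^+ 2 <= t ->
  \sum_(k < n) u k `^ (2 * q) * r ^+ k <= bohr_bracket (2 * q) r (Num.sqrt t).
Proof.
move=> q01 /andP[t0 t2] rt u0 H at_; have [q0 q1] := andP q01.
have r0 : 0 < r by rewrite rt powR_gt0.
pose b := Num.sqrt t; have b0 : 0 < b by rewrite sqrtr_gt0.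
have b2 : b ^+ 2 = t by rewrite sqr_sqrtr // ltW.
have rb : r = b `^ (2 - 2 * q).
  by rewrite rt -b2 -powR_mulrn ?(ltW b0) // -powRrM; congr (_ `^ _); ring.
have rho1 : r * b `^ (2 * q - 2) = 1.
  by rewrite rb -opprB powRN mulVf // gt_eqF // powR_gt0.
set w0 := b `^ (2 * q - 2) in rho1.
have w00 : 0 < w0 by rewrite powR_gt0.
pose c := 1 - t; have c0 : 0 < c by rewrite /c; lra.
pose W := c `^ (2 * q - 2); have W0 : 0 < W by rewrite powR_gt0.
have q01' : 0 < q <= 1 by rewrite q0 ltW.
have bp : b `^ (2 * q) = w0 * t by rewrite -b2 powRD2.
have bracketE : bohr_bracket (2 * q) r b = w0 * t + r * W * c.
  rewrite /bohr_bracket bp mulrA rho1 mul1r b2 -/c -[c `^ (2 * q)]powRD2 // -/W.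
  by field; rewrite gt_eqF.
rewrite bracketE.
case: n => [|n]; first by rewrite big_ord0 addr_ge0 ?mulr_ge0 ?(ltW w00) ?(ltW t0) ?(ltW r0)
    ?(ltW W0) ?(ltW c0).
rewrite big_ord_recl expr0 mulr1.
have h0 : u 0%N `^ (2 * q) <= w0 * (t + q * (u 0%N ^+ 2 - t)).
  apply: le_trans (powR_tangent q01' (u0 _) b0) _; rewrite b2 ler_wpM2l ?(ltW w00) //.
  by rewrite lerBlDr lerDl mulr_ge0 ?sqr_ge0 // mulr_ge0 ?subr_ge0 // ltW.
have h1 : \sum_(i < n) u (bump 0 i) `^ (2 * q) * r ^+ (bump 0 i) <=
   r * W * ((1 - q) * (c ^+ 2 * \sum_(k < n) t ^+ k) + q * \sum_(k < n) u k.+1 ^+ 2).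
  rewrite !mulr_sumr -big_split /= mulr_sumr ler_sum // => k _.
  rewrite /bump /= [r ^+ _]exprS mulrCA -[r * W * _]mulrA ler_wpM2l ?(ltW r0) //.
  apply: le_trans (geometric_tangent _ q01' (ltW r0) b0 c0 (u0 _)) _.
  rewrite -/W -/w0 rho1 expr1n mulr1 ler_wpM2l ?(ltW W0) // exprMn -exprM mulnC exprM b2.
  have : 0 <= q * (1 - q) * (u k.+1 - c * b ^+ k) ^+ 2.
    by rewrite mulr_ge0 ?sqr_ge0 // mulr_ge0 ?subr_ge0 // ltW.
  by move: (c ^+ 2 * _) (u k.+1 ^+ 2) (_ * (_ - _) ^+ 2) => x y z; lra.
have g : c ^+ 2 * \sum_(k < n) t ^+ k <= c.
  have t01 : 0 <= t < 1 by rewrite (ltW t0) /=; lra.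
  apply: le_trans (ler_wpM2l (exprn_ge0 2 (ltW c0)) (geometric_sum_le n t01)) _.
  by rewrite -/c expr2 mulfK // gt_eqF.
have s : \sum_(k < n) u k.+1 ^+ 2 <= 1 - u 0%N ^+ 2.
  by have := H n.+1; rewrite big_ord_recl /= /bump /=; lra.
have rWw : r * W <= w0.
  rewrite -(ler_pM2l r0) rho1 mulrA -expr2.
  have -> : r ^+ 2 = t `^ (2 - 2 * q).
    by rewrite rt -powR_mulrn ?powR_ge0 // -powRrM; congr (_ `^ _); ring.
  rewrite /W -[2 * q - 2]opprB powRN -ler_pdivlMr ?invr_gt0 ?powR_gt0 // div1r invrK.
  rewrite ge0_ler_powR ?nnegrE ?(ltW t0) ?(ltW c0) //; rewrite /c; lra.
have rW0 : 0 < r * W by rewrite mulr_gt0.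
apply: le_trans (lerD h0 h1) _.
have h2 : (1 - q) * (c ^+ 2 * \sum_(k < n) t ^+ k) + q * \sum_(k < n) u k.+1 ^+ 2
   <= (1 - q) * c + q * (1 - u 0%N ^+ 2).
  by rewrite lerD // ler_wpM2l ?subr_ge0 // ltW.
apply: le_trans (lerD (lexx _) (ler_wpM2l (ltW rW0) h2)) _.
have h3 : 0 <= q * ((w0 - r * W) * (t - u 0%N ^+ 2)).
  by rewrite mulr_ge0 ?(ltW q0) // mulr_ge0 ?subr_ge0.
rewrite -subr_ge0; apply: le_trans h3 _; rewrite le_eqVlt; apply/orP; left; apply/eqP.
rewrite /c; ring.
Qed.

(** For this comparison sequence all weighted slopes are equal, so that [u] enters
    the sum of the tangents only through [\sum_k u k ^+ 2], which is at most 1,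
    the sum of the squares of the comparison sequence. *)
Lemma powered_sum_deficit (q r t : R) (u : nat -> R) n : 0 < q < 1 -> 0 < t < 1 ->
  r = t `^ (1 - q) -> (forall k, 0 <= u k) ->
  (forall m, \sum_(k < m) u k ^+ 2 <= 1) ->
  \sum_(k < n) u k `^ (2 * q) * r ^+ k <= (1 / (1 - t)) `^ (1 - q) *
    (1 - q * (1 - q) * \sum_(k < n) (u k - Num.sqrt ((1 - t) * t ^+ k)) ^+ 2).
Proof.
move=> q01 /andP[t0 t1] rt u0 H; have [q0 q1] := andP q01.
have r0 : 0 < r by rewrite rt powR_gt0.
pose b := Num.sqrt t; have b0 : 0 < b by rewrite sqrtr_gt0.
have b2 : b ^+ 2 = t by rewrite sqr_sqrtr // ltW.
have rb : r = b `^ (2 - 2 * q).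
  by rewrite rt -b2 -powR_mulrn ?(ltW b0) // -powRrM; congr (_ `^ _); ring.
have rho1 : r * b `^ (2 * q - 2) = 1.
  by rewrite rb -opprB powRN mulVf // gt_eqF // powR_gt0.
have t1' : 0 < 1 - t by rewrite subr_gt0.
pose c := Num.sqrt (1 - t); have c0 : 0 < c by rewrite sqrtr_gt0.
have c2 : c ^+ 2 = 1 - t by rewrite sqr_sqrtr // ltW.
have vE k : Num.sqrt ((1 - t) * t ^+ k) = c * b ^+ k.
  rewrite sqrtrM ?(ltW t1') //; congr (_ * _).
  have bk : 0 <= b ^+ k by rewrite exprn_ge0 // ltW.
  by rewrite -[b ^+ k]ger0_norm // -sqrtr_sqr -exprM mulnC exprM b2.
have UE : (1 / (1 - t)) `^ (1 - q) = c `^ (2 * q - 2).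
  rewrite div1r -c2 -powR_inv1 ?exprn_ge0 ?(ltW c0) // -powR_mulrn ?(ltW c0) // -!powRrM.
  by congr (_ `^ _); ring.
rewrite UE; set U := c `^ _; have U0 : 0 < U by rewrite powR_gt0.
have q01' : 0 < q <= 1 by rewrite q0 ltW.
apply: (@le_trans _ _ (U * \sum_(k < n) ((1 - q) * ((1 - t) * t ^+ k) + q * u k ^+ 2
   - q * (1 - q) * (u k - Num.sqrt ((1 - t) * t ^+ k)) ^+ 2))).
  rewrite mulr_sumr ler_sum // => k _.
  apply: le_trans (geometric_tangent _ q01' (ltW r0) b0 c0 (u0 _)) _.
  rewrite -/U rho1 expr1n mulr1 ler_wpM2l ?(ltW U0) // vE exprMn -exprM mulnC exprM b2 c2.
  by move: (t ^+ k) (u k ^+ 2) (_ * (_ - _) ^+ 2) => x y z; lra.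
rewrite ler_wpM2l ?(ltW U0) // sumrB big_split /= -!mulr_sumr lerD2r.
have h : (1 - t) * \sum_(k < n) t ^+ k <= 1.
  by rewrite -[1 - t]opprB mulNr -subrX1 opprB lerBlDr lerDl exprn_ge0 // ltW.
have := H n; move: (\sum_(k < n) u k ^+ 2) => s s1.
have : (1 - q) * ((1 - t) * \sum_(k < n) t ^+ k) <= (1 - q) * 1 by rewrite ler_wpM2l ?subr_ge0 // ltW.
have : q * s <= q * 1 by rewrite ler_wpM2l // ltW.
lra.
Qed.

(** The two comparisons above, according to the position of [u 0 ^+ 2] relative to
    [t] (for [q = 1], always the first).  They break down for [r = 0], where only the first term counts, and for
    [q = 1], [u 0 = 0], where the comparison sequence has ratio 0 and
    [r * \sum_k u k.+1 ^+ 2 <= r] is the bound. *)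
Lemma powered_sum_le_bracket (q r : R) (u : nat -> R) : 0 < q <= 1 ->
  0 <= r <= 2 `^ (q - 1) -> (forall k, 0 <= u k) -> u 0%N < 1 ->
  (forall m, \sum_(k < m) u k ^+ 2 <= 1) ->
  (forall m, (1 - u 0%N ^+ 2) * (\sum_(k < m) u k.+1 ^+ 2) + u m.+1 ^+ 2
       <= (1 - u 0%N ^+ 2) ^+ 2) ->
  exists2 a : R, 0 <= a <= 1 &
   forall n, \sum_(k < n) u k `^ (2 * q) * r ^+ k <= bohr_bracket (2 * q) r a.
Proof.
move=> q01 /andP[r_ge0 rle] u0 u1 H1 H; have [q0 q1] := andP q01.
have a01 : 0 <= u 0%N <= 1 by rewrite u0 ltW.
move: r_ge0; rewrite le_eqVlt => /predU1P[<-|r0].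
  exists (u 0%N) => // n; rewrite /bohr_bracket !mul0r addr0.
  case: n => [|n]; first by rewrite big_ord0 powR_ge0.
  rewrite big_ord_recl expr0 mulr1 big1 ?addr0 // => k _.
  by rewrite /bump /= expr0n mulr0.
move: q1; rewrite le_eqVlt => /predU1P[qE|q1].
  have r1 : r <= 1 by rewrite qE subrr powRr0 in rle.
  exists (u 0%N) => // n.
  have [a0|a0] := eqVneq (u 0%N) 0; last first.
    apply: powered_sum_bracket => //; rewrite ?(ltW r0) //.
      by rewrite lt_neqAle eq_sym a0 u0.
    by rewrite qE mulr1 subrr powRr0 mulr1.
  have -> : bohr_bracket (2 * q) r (u 0%N) = r.
    rewrite /bohr_bracket a0 powR0 ?mulf_neq0 ?gt_eqF // expr0n /= subr0 powR1.
    by rewrite mulr0 subr0 add0r divr1 mulr1.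
  case: n => [|n]; first by rewrite big_ord0 ltW.
  rewrite big_ord_recl a0 powR0 ?mulf_neq0 ?gt_eqF // mul0r add0r.
  apply: (@le_trans _ _ (r * \sum_(k < n) u k.+1 ^+ 2)).
    rewrite mulr_sumr ler_sum // => k _; rewrite /bump /= qE mulr1 powR_mulrn //.
    rewrite mulrC ler_wpM2r ?exprn_ge0 // [r ^+ _]exprS.
    by rewrite ler_piMr ?(ltW r0) // exprn_ile1 // ltW.
  rewrite ler_piMr ?(ltW r0) //; have := H1 n.+1.
  by rewrite big_ord_recl a0 expr0n add0r.
have q1' : 0 < 1 - q by rewrite subr_gt0.
pose t := r `^ (1 - q)^-1.
have t0 : 0 < t by rewrite powR_gt0.
have rt : r = t `^ (1 - q) by rewrite /t -powRrM mulVf ?gt_eqF // powRr1 // ltW.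
have t2 : t <= 1 / 2.
  have -> : 1 / 2 = (2 `^ (q - 1)) `^ (1 - q)^-1 :> R.
    rewrite -powRrM (_ : (q - 1) / (1 - q) = -1) ?powR_inv1 ?div1r //.
    by field; rewrite gt_eqF.
  by rewrite ge0_ler_powR ?nnegrE ?powR_ge0 ?invr_ge0 ?(ltW q1') ?(ltW r0).
have [ut|tu] := leP (u 0%N ^+ 2) t.
  exists (Num.sqrt t).
    by rewrite sqrtr_ge0 -[leRHS]sqrtr1 ler_wsqrtr //; lra.
  by move=> n; apply: powered_sum_bracket_small; rewrite ?q0 ?t0.
have a0 : 0 < u 0%N.
  rewrite lt_neqAle u0 andbT; apply/eqP => e.
  by move: tu; rewrite -e expr0n /= ltNge (ltW t0).
exists (u 0%N) => // n; apply: powered_sum_bracket; rewrite ?(ltW r0) ?a0 //.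
rewrite -[2 * q - 2]opprB powRN -ler_pdivlMr ?invr_gt0 ?powR_gt0 // div1r invrK.
have -> : u 0%N `^ (2 - 2 * q) = (u 0%N ^+ 2) `^ (1 - q).
  by rewrite (_ : 2 - 2 * q = 2 * (1 - q)) ?powRrM ?powR_mulrn //; ring.
by rewrite rt ge0_ler_powR ?nnegrE ?exprn_ge0 ?(ltW t0) ?(ltW q1') ?(ltW tu).
Qed.

End PoweredSums.

(** * The maximum of the bracket *)

Section BracketMaximum.
Variable R : realType.

(** The norm is there because [x `^ p = 1] for [x < 0], which breaks continuity at
    0. *)
Lemma continuous_powR_norm (p : R) : 0 < p -> continuous (fun x : R => `|x| `^ p).
Proof.
move=> p0 x; have [->|x0] := eqVneq x 0.
  apply/cvgrPdist_lt => e e0; rewrite normr0 powR0 ?gt_eqF //.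
  near=> y; rewrite sub0r normrN ger0_norm ?powR_ge0 //.
  have h : `|y| < e `^ p^-1.
    by near: y; apply: (@nbhs0_lt R R^o); rewrite powR_gt0.
  have -> : e = (e `^ p^-1) `^ p by rewrite -powRrM mulVf ?gt_eqF // powRr1 // ltW.
  by rewrite gt0_ltr_powR // nnegrE // powR_ge0.
apply: (@continuous_comp _ _ _ (fun y : R => `|y|) (fun y => y `^ p)).
  exact: norm_continuous.
apply: differentiable_continuous; apply/derivable1_diffP.
by apply: derivable_powR; rewrite in_itv /= andbT normr_gt0.
Unshelve. all: by end_near.
Qed.

Lemma bohr_bracket_max (p r : R) : 0 < p -> 0 <= r < 1 ->
  exists2 c : R, 0 <= c <= 1 &
    forall a, 0 <= a <= 1 -> bohr_bracket p r a <= bohr_bracket p r c.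
Proof.
move=> p0 /andP[r0 r1].
pose F (a : R) := `|a| `^ p + r * `|1 - a ^+ 2| `^ p / (1 - r * `|a| `^ p).
have FE a : 0 <= a <= 1 -> F a = bohr_bracket p r a.
  move=> /andP[a0 a1]; rewrite /F /bohr_bracket !ger0_norm //.
  by rewrite subr_ge0 exprn_ile1.
have Fc : {within `[0, 1], continuous F}.
  apply: continuous_in_subspaceT => a; rewrite inE /= in_itv /= => /andP[a0 a1].
  have ca := @continuous_powR_norm _ p0 a.
  have cD : `|1 - x ^+ 2| `^ p @[x --> a] --> `|1 - a ^+ 2| `^ p.
    apply: (@continuous_comp _ _ _ (fun x : R => 1 - x ^+ 2) (fun y => `|y| `^ p)).
      apply: (@cvgB _ R^o); first exact: cvg_cst.
      by apply: cvgM; exact: cvg_id.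
    exact: continuous_powR_norm.
  apply: cvgD => //; apply: cvgM; first by apply: cvgM => //; exact: cvg_cst.
  apply: cvgV.
    rewrite subr_eq0 eq_sym lt_eqF // -[ltRHS]mulr1; apply: le_lt_trans (_ : r * 1 < _).
      have e1 : 1 `^ p = 1 :> R by rewrite powR1.
      rewrite ler_wpM2l // ger0_norm // -[leRHS]e1 ge0_ler_powR ?nnegrE //.
      exact: ltW.
    by rewrite !mulr1.
  apply: cvgB; first exact: cvg_cst.
  by apply: cvgM => //; exact: cvg_cst.
have [c] := EVT_max ler01 Fc; rewrite in_itv /= => c01 H.
exists c => // a a01; rewrite -!FE //; apply: H; by rewrite in_itv.
Qed.

Lemma bohr_bracket1 (p r : R) : p != 0 -> bohr_bracket p r 1 = 1.
Proof.
by move=> p0; rewrite /bohr_bracket powR1 expr1n subrr powR0 // mulr0 mul0r addr0.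
Qed.

(** The denominator does not vanish if [r < 1].  Otherwise [p = 2] and [r = 1], and
    the bracket is constant. *)
Lemma exists_bohr_bracket_max (p r : R) : 0 < p <= 2 -> 0 <= r <= 2 `^ (p / 2 - 1) ->
  exists2 c : R, 0 <= c <= 1 &
    forall a, 0 <= a <= 1 -> bohr_bracket p r a <= bohr_bracket p r c.
Proof.
move=> /andP[p0 p2] /andP[r0 rle].
have [r1|r1] := ltP r 1; first by apply: bohr_bracket_max; rewrite ?r0.
have pE : p = 2.
  apply/eqP; rewrite eq_le p2 /= leNgt; apply/negP => plt.
  have : 1 <= 2 `^ (p / 2 - 1) := le_trans r1 rle.
  rewrite leNgt => /negP; apply.
  rewrite /powR gt_eqF // -[ltRHS]expR0 ltr_expR pmulr_llt0 ?ln_gt0 ?ltr1n //; lra.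
have rE : r = 1.
  by apply/eqP; rewrite eq_le r1 (le_trans rle) // pE divff // subrr powRr0.
exists 1; first by rewrite ler01 lexx.
move=> a /andP[a0 a1]; rewrite bohr_bracket1 ?gt_eqF // pE rE.
move: a1; rewrite le_eqVlt => /predU1P[->|a1]; first by rewrite bohr_bracket1.
rewrite /bohr_bracket !powR_mulrn // ?subr_ge0 ?exprn_ile1 ?(ltW a1) // !mul1r.
have D0 : 1 - a ^+ 2 != 0 by rewrite gt_eqF // subr_gt0 exprn_ilt1.
move: (a ^+ 2) D0 => x D0.
have -> : (1 - x) ^+ 2 / (1 - x) = 1 - x by rewrite expr2 mulfK.
by rewrite addrC subrK.
Qed.

End BracketMaximum.

(** * Disc automorphisms and the supremum *)

Section Supremum.
Variable R : realType.
Local Notation C := (Cplx R).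
Local Notation normc := (@ComplexField.Normc.normc R).
Local Notation toC := (fun x : R => (x%:C)%C : C).

Definition mobius_coef (C : pzRingType) (a : C) k :=
  if k is k'.+1 then - ((1 - a ^+ 2) * a ^+ k') else a.

Definition mobius (C : fieldType) (a z : C) := (a - z) / (1 - a * z).

Lemma mobius_partial_sum (a z : C) n : 1 - a * z != 0 ->
  mobius a z - series (fun k => mobius_coef a k * z ^+ k) n.+1
    = - ((1 - a ^+ 2) * z / (1 - a * z)) * (a * z) ^+ n.
Proof.
move=> d0; rewrite /series /= big_nat_recl // expr0 mulr1.
have -> : \sum_(0 <= i < n) mobius_coef a i.+1 * z ^+ i.+1 =
    - ((1 - a ^+ 2) * z) * \sum_(i < n) (a * z) ^+ i.
  rewrite big_mkord mulr_sumr; apply: eq_bigr => i _.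
  by rewrite exprMn /= [z ^+ i.+1]exprS; ring.
have : (1 - a * z) * \sum_(i < n) (a * z) ^+ i = 1 - (a * z) ^+ n.
  by rewrite -[RHS]opprB subrX1 -[RHS]mulNr [in RHS]opprB.
move: (\sum_(i < n) _) ((a * z) ^+ n) => S P h.
have {h}-> : P = 1 - (1 - a * z) * S by rewrite h opprB addrC subrK.
by rewrite /mobius /=; field.
Qed.

Lemma mobius_bohr (a : R) : 0 <= a < 1 ->
  bohr_class (mobius (toC a)) /\ power_series_on_disc (mobius (toC a)) (mobius_coef (toC a)).
Proof.
move=> /andP[a0 a1].
have A0 : 0 <= toC a by rewrite -[0]/(toC 0) lecR.
have A1 : toC a < 1 by rewrite -[1]/(toC 1) ltcR.
have A01 : 0 <= toC a < 1 by rewrite A0.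
have den (z : C) : `|z| < 1 -> 1 - toC a * z != 0.
  move=> z1; rewrite subr_eq0; apply/eqP => e.
  have : `|toC a * z| < 1.
    rewrite normrM (ger0_norm A0); apply: le_lt_trans (_ : toC a * 1 < 1).
      by rewrite ler_wpM2l // ltW.
    by rewrite mulr1.
  by rewrite -e normr1 ltxx.
move: A0 A1 A01 den; move: (toC a) => A A0 A1 A01 den.
have ps : power_series_on_disc (mobius A) (mobius_coef A).
  move=> z z1; have d0 := den z z1.
  apply/cvgrPdist_lt => e e0.
  have e2 : 0 < e / 2 by rewrite divr_gt0.
  have K0 := normr_ge0 ((1 - A ^+ 2) * z / (1 - A * z)).
  have [N HN] := geometric_small A01 e2 K0.
  exists N.+1 => // -[//|n] /= Nn.
  rewrite mobius_partial_sum // normrM normrN.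
  apply: (@le_lt_trans _ _ (e / 2)); last first.
    by rewrite ltr_pdivrMr // mulr_natr mulr2n ltrDl.
  apply: le_trans (HN n Nn); rewrite ler_wpM2l //.
  rewrite exprMn normrM !normrX (ger0_norm A0) -[leRHS]mulr1 ler_wpM2l ?exprn_ge0 //.
  by rewrite exprn_ile1 // ltW.
split => //; split; first by exists (mobius_coef A).
move=> z z1; rewrite normrM normfV ltr_pdivrMr ?normr_gt0 ?den // mul1r.
rewrite -(@ltr_pXn2r _ 2) ?nnegrE // -subr_gt0 !normCK !rmorphB !rmorphM rmorph1 /=.
rewrite (conj_Creal (ger0_real A0)).
have -> : (1 - A * z) * (1 - A * z^*) - (A - z) * (A - z^*) = (1 - A ^+ 2) * (1 - `|z| ^+ 2).
  by rewrite normCK; ring.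
by rewrite mulr_gt0 ?subr_gt0 ?exprn_ilt1.
Qed.

Lemma mobius_powered_sum (p r a : R) : 0 < p -> 0 <= r <= 1 -> 0 <= a < 1 ->
  powered_bohr_sum p (mobius_coef (toC a) : nat -> C) r = (bohr_bracket p r a)%:E.
Proof.
move=> p0 /andP[r0 r1] /andP[a0 a1].
have nr (x : R) : normc (toC x) = `|x| by rewrite /= expr0n addr0 sqrtr_sqr.
have D0 : 0 <= 1 - a ^+ 2 by rewrite subr_ge0 exprn_ile1 // ltW.
pose g k := normc (mobius_coef (toC a) k : C) `^ p * r ^+ k.
have g0 : g 0%N = a `^ p by rewrite /g expr0 mulr1 /mobius_coef nr ger0_norm.
have gS k : g k.+1 = geometric (r * (1 - a ^+ 2) `^ p) (r * a `^ p) k.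
  have -> : g k.+1 = normc (toC (- ((1 - a ^+ 2) * a ^+ k))) `^ p * r ^+ k.+1.
    by rewrite /g /mobius_coef; congr (normc _ `^ _ * _);
       rewrite rmorphN rmorphM rmorphB !rmorphXn rmorph1.
  rewrite nr normrN ger0_norm ?mulr_ge0 ?exprn_ge0 // powRM ?exprn_ge0 //.
  rewrite -[a ^+ k]powR_mulrn // powRAC powR_mulrn ?powR_ge0 //=.
  by rewrite [r ^+ k.+1]exprS [(r * _) ^+ k]exprMn; ring.
have ap1 : a `^ p < 1.
  have e1 : 1 `^ p = 1 :> R by rewrite powR1.
  by rewrite -[ltRHS]e1 gt0_ltr_powR ?nnegrE.
have z1 : `|r * a `^ p| < 1.
  rewrite ger0_norm ?mulr_ge0 ?powR_ge0 //; apply: le_lt_trans ap1.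
  by rewrite ler_piMl // powR_ge0.
have cg : series g @ \oo --> bohr_bracket p r a.
  rewrite -cvg_shiftS.
  have -> : [sequence series g n.+1]_n =
     (fun n => g 0%N + series (geometric (r * (1 - a ^+ 2) `^ p) (r * a `^ p)) n).
    apply/funext => n; rewrite /series /= big_nat_recl //; congr (_ + _).
    by apply: eq_bigr => k _; rewrite gS.
  rewrite g0; apply: cvgD; first exact: cvg_cst.
  exact: cvg_geometric_series.
rewrite /powered_bohr_sum; apply: cvg_lim => //.
have -> : (fun n => (\sum_(0 <= k < n) (g k)%:E)%E) = EFin \o series g.
  by apply/funext => n; rewrite /= /series /= sumEFin.
by apply: cvg_EFin => //; exact: nearW.
Qed.

Lemma powered_bohr_sum_le (p r M : R) (a : nat -> C) : 0 <= r ->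
  (forall n, \sum_(k < n) normc (a k) `^ p * r ^+ k <= M) ->
  (powered_bohr_sum p a r <= M%:E)%E.
Proof.
move=> r0 H; apply: lime_le.
  by apply: is_cvg_nneseries => n _ _; rewrite lee_fin mulr_ge0 ?powR_ge0 ?exprn_ge0.
by apply: nearW => n; rewrite sumEFin lee_fin big_mkord.
Qed.

(** For [a = 1] there is no automorphism; the value 1 of the bracket is the limit
    of the first terms [a `^ p] for [a < 1]. *)
Lemma bracket_le_sup (p r a : R) : 0 < p -> 0 <= r <= 1 -> 0 <= a <= 1 ->
  ((bohr_bracket p r a)%:E <= powered_bohr_sup p r)%E.
Proof.
move=> p0 r01 /andP[a0].
have lt1 b : 0 <= b < 1 -> ((bohr_bracket p r b)%:E <= powered_bohr_sup p r)%E.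
  move=> b01; rewrite -mobius_powered_sum //; apply: ereal_sup_ubound.
  have [fB fa] := mobius_bohr b01.
  by exists (mobius (toC b)), (mobius_coef (toC b)).
rewrite le_eqVlt => /predU1P[->|a1]; last by apply: lt1; rewrite a0.
have [r0 r1] := andP r01.
have pow b : 0 <= b < 1 -> ((b `^ p)%:E <= powered_bohr_sup p r)%E.
  move=> b01; apply: le_trans (lt1 b b01); have [b0 b1] := andP b01.
  rewrite lee_fin lerDl divr_ge0 ?mulr_ge0 ?powR_ge0 // subr_ge0.
  have : b `^ p <= 1 `^ p by rewrite ge0_ler_powR ?nnegrE // ltW.
  rewrite powR1 => bp; apply: le_trans bp; by rewrite ler_piMl // powR_ge0.
rewrite bohr_bracket1 ?gt_eqF // leNgt; apply/negP.
have := pow 0; rewrite lexx ltr01 powR0 ?gt_eqF // => /(_ isT).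
move: pow; case: (powered_bohr_sup p r) => [s| |] // pow; rewrite lee_fin lte_fin => s0 s1.
have b0 : 0 <= (s + 1) / 2 by lra.
have := pow (((s + 1) / 2) `^ p^-1); rewrite -powRrM mulVf ?gt_eqF // powRr1 // lee_fin.
rewrite powR_ge0 /=.
have -> : ((s + 1) / 2) `^ p^-1 < 1.
  have e1 : 1 `^ p^-1 = 1 :> R by rewrite powR1.
  rewrite -[ltRHS]e1 gt0_ltr_powR ?nnegrE ?invr_gt0 //; lra.
by move=> /(_ isT); lra.
Qed.

End Supremum.

Theorem theorem1 (R : realType) (p : R) (hp : 0 < p <= 2) :
  (forall r : R, 0 <= r <= 2 `^ (p / 2 - 1) ->
     exists2 m : R,
       is_maximum [set bohr_bracket p r a | a in [set a : R | 0 <= a <= 1]] m &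
       powered_bohr_sup p r = m%:E) /\
  (forall r : R, 2 `^ (p / 2 - 1) < r < 1 ->
     (powered_bohr_sup p r <
        ((1 / (1 - r `^ (2 / (2 - p)))) `^ (1 - p / 2))%:E)%E).
Proof.
have [p0 p2] := andP hp.
have p2q : 2 * (p / 2) = p by rewrite mulrC divfK.
have q01 : 0 < p / 2 <= 1 by lra.
split=> r.
  move=> rle; have [c c01 cmax] := exists_bohr_bracket_max hp rle.
  have r1 : r <= 1.
    case/andP: rle => _ /le_trans; apply.
    rewrite -[leRHS](powRr0 2) ler_powR ?ler1n //; lra.
  have [r0 _] := andP rle.
  exists (bohr_bracket p r c).
    by split; [exists c | move=> _ [a a01 <-]; apply: cmax].
  apply/le_anti/andP; split; last by apply: bracket_le_sup; rewrite ?r0.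
  apply: ub_ereal_sup => _ [f [a [fB fa ->]]].
  have Ta := bohr_class_contraction fB fa.
  have a1 := bohr_class_coef0 fB fa.
  have [b b01 Hb] := powered_sum_le_bracket q01 rle (fun k => normc_ge0 (a k)) a1
    (fun m => contraction_sum_normc m Ta) (fun m => contraction_tail_normc m Ta a1).
  apply: powered_bohr_sum_le => // n.
  by apply: le_trans (cmax b b01); rewrite -p2q; exact: Hb.
move=> /andP[rgt r1].
have plt : p < 2.
  rewrite lt_neqAle p2 andbT; apply/eqP => pE.
  by move: rgt; rewrite pE divff // subrr powRr0 ltNge (ltW r1).
set q := p / 2 in p2q q01 rgt *.
have q1 : 0 < 1 - q by rewrite /q; lra.
have q01' : 0 < q < 1 by lra.
have r0 : 0 < r by apply: lt_trans rgt; rewrite powR_gt0.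
have -> : 2 / (2 - p) = (1 - q)^-1 by rewrite -p2q; field; rewrite ?gt_eqF //; lra.
set t := r `^ (1 - q)^-1.
have t0 : 0 < t by rewrite powR_gt0.
have rt : r = t `^ (1 - q) by rewrite /t -powRrM mulVf ?gt_eqF // powRr1 // ltW.
have iq : 0 < (1 - q)^-1 by rewrite invr_gt0.
have t1 : t < 1.
  have e1 : 1 `^ (1 - q)^-1 = 1 :> R by rewrite powR1.
  by rewrite -[ltRHS]e1 gt0_ltr_powR ?nnegrE ?(ltW r0).
have t2 : 1 / 2 < t.
  have -> : 1 / 2 = (2 `^ (q - 1)) `^ (1 - q)^-1 :> R.
    rewrite -powRrM (_ : (q - 1) / (1 - q) = -1) ?powR_inv1 ?div1r //.
    by field; rewrite gt_eqF.
  by rewrite gt0_ltr_powR ?nnegrE ?powR_ge0 ?(ltW r0).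
have t12 : 1 / 2 < t < 1 by rewrite t2.
have [d d0 gap] := contraction_gap t12.
set U := (1 / (1 - t)) `^ (1 - q).
have U0 : 0 < U by rewrite powR_gt0 // divr_gt0 // subr_gt0.
have qq : 0 < q * (1 - q) by rewrite mulr_gt0 //; lra.
apply: (@le_lt_trans _ _ (U * (1 - q * (1 - q) * d ^+ 2))%:E); last first.
  rewrite lte_fin -[ltRHS]mulr1 ltr_pM2l // ltrBlDr ltrDl mulr_gt0 //.
  by rewrite exprn_gt0.
apply: ub_ereal_sup => _ [f [a [fB fa ->]]].
have Ta := bohr_class_contraction fB fa.
have [k dk] := gap a Ta.
apply: powered_bohr_sum_le => [|n]; first exact: ltW.
have t01 : 0 < t < 1 by rewrite t0.
have := powered_sum_deficit (k.+1 + n) q01' t01 rt (fun k => normc_ge0 (a k))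
    (fun m => contraction_sum_normc m Ta).
rewrite p2q => h.
have h1 : \sum_(k < n) ComplexField.Normc.normc (a k) `^ p * r ^+ k <=
  \sum_(k < k.+1 + n) ComplexField.Normc.normc (a k) `^ p * r ^+ k.
  rewrite addnC big_split_ord /= lerDl sumr_ge0 // => i _.
  by rewrite mulr_ge0 ?powR_ge0 ?exprn_ge0 ?(ltW r0).
apply: le_trans h1 (le_trans h _); rewrite ler_wpM2l ?(ltW U0) // lerD2l lerN2.
rewrite ler_wpM2l ?(ltW qq) // big_split_ord /= big_ord_recr /=.
apply: (@le_trans _ _ ((ComplexField.Normc.normc (a k) - Num.sqrt ((1 - t) * t ^+ k)) ^+ 2)).
  by rewrite -[leRHS]real_normK ?num_real // ler_pXn2r ?nnegrE ?(ltW d0) // ltW.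
rewrite addrAC lerDr addr_ge0 // sumr_ge0 // => i _; exact: sqr_ge0.
Qed.
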